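(* Let $p(\cdot)\in P^{\log}(\mathbb{R})$ with $1<p^-\le p^+<\infty$, let $1\le q<\infty$, let $w\in A_{p(\cdot)}$ be a weight on $\mathbb{R}$, and assume that the Hardy–Littlewood maximal operator $M$ is bounded on the amalgam space $(L_w^{p(\cdot)},\ell^q)$. Let $\varphi_\varepsilon$, $\varepsilon>0$, be a mollifier on $\mathbb{R}$. Then a subset $\mathcal{F}\subset (L_w^{p(\cdot)},\ell^q)$ is totally bounded if and only if the following three conditions hold: (i) $\mathcal{F}$ is bounded in $(L_w^{p(\cdot)},\ell^q)$, i.e. $\sup_{f\in\mathcal{F}}\|f\|_{(L_w^{p(\cdot)},\ell^q)}<\infty$; (ii) for every $\varepsilon>0$ there is some $\gamma>0$ such that for all $f\in\mathcal{F}$, $\|f\,\chi_{\{|x|>\gamma\}}\|_{(L_w^{p(\cdot)},\ell^q)}<\varepsilon$; (iii) $\lim_{\varepsilon\to0^+}\|f*\varphi_\varepsilon-f\|_{(L_w^{p(\cdot)},\ell^q)}=0$ uniformly for $f\in\mathcal{F}$.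
   Context: All functions are on $\mathbb{R}$ (functions equal a.e. are identified). A variable exponent is a measurable $p(\cdot):\mathbb{R}\to[1,\infty)$; $p^-=\operatorname{ess\,inf}p$, $p^+=\operatorname{ess\,sup}p$. $P^{\log}(\mathbb{R})$ is the class of exponents for which there are $C>0$ and $p_\infty>1$ with $|p(x)-p(y)|\le C/\log(e+1/|x-y|)$ and $|p(x)-p_\infty|\le C/\log(e+|x|)$ for all $x,y$. A weight is a measurable, locally integrable function $w:\mathbb{R}\to(0,\infty)$. For a measurable function $f$, $\|f\|_{p(\cdot)}=\inf\{\lambda>0:\int|f(x)/\lambda|^{p(x)}dx\le1\}$, and $L_w^{p(\cdot)}(\mathbb{R})$ is the space of measurable $f$ with $\|f\|_{L_w^{p(\cdot)}(\mathbb{R})}=\|f w^{1/p(\cdot)}\|_{p(\cdot)}<\infty$. $w\in A_{p(\cdot)}$ means $\sup_{B}|B|^{-p_B}\|w\|_{L^1(B)}\left\|\frac1w\right\|_{L^{p'(\cdot)/p(\cdot)}(B)}<\infty$, the supremum over all balls $B$, where $p_B=\left(\frac1{|B|}\int_B\frac{dx}{p(x)}\right)^{-1}$, $\frac1{p(\cdot)}+\frac1{p'(\cdot)}=1$, and $\|\cdot\|_{L^{s(\cdot)}(B)}$ denotes the expression $\inf\{\lambda>0:\int_B|f/\lambda|^{s(x)}dx\le1\}$ (also when $s$ takes values below $1$). Amalgam space: $L^{p(\cdot)}_{loc,w}(\mathbb{R})$ is the space of functions $f$ with $f\chi_K\in L_w^{p(\cdot)}(\mathbb{R})$ for every compact $K$.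 With $J_k=[k,k+1)$, $(L_w^{p(\cdot)},\ell^q)$ is the Banach space of $f\in L^{p(\cdot)}_{loc,w}(\mathbb{R})$ with $\|f\|_{(L_w^{p(\cdot)},\ell^q)}=\left(\sum_{k\in\mathbb{Z}}\|f\chi_{J_k}\|_{L_w^{p(\cdot)}(\mathbb{R})}^q\right)^{1/q}<\infty$. Maximal operator: $Mf(x)=\sup_{r>0}\frac1{|B(x,r)|}\int_{B(x,r)}|f(y)|dy$; boundedness means $\|Mf\|\le C\|f\|$ in the given norm. Mollifier: $\varphi:\mathbb{R}\to\mathbb{R}$ is a nonnegative, radial, (radially) decreasing $C_0^\infty$ function with $\varphi(x)=0$ for $|x|\ge1$ and $\int\varphi=1$; $\varphi_\varepsilon(x)=\varepsilon^{-1}\varphi(x/\varepsilon)$, and $\varphi_\varepsilon*f(x)=\int\varphi_\varepsilon(x-y)f(y)dy$. A set is totally bounded if for every $\varepsilon>0$ it has a finite $\varepsilon$-net. *)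

(* Defs.v *)
(* MathComp-Analysis *)
From HB Require Import structures.
From mathcomp Require Import all_boot all_order all_algebra.
From mathcomp Require Import all_classical all_reals all_analysis ess_sup_inf.

Set Implicit Arguments.
Unset Strict Implicit.
Unset Printing Implicit Defensive.

Import Order.TTheory GRing.Theory Num.Theory.
Import numFieldNormedType.Exports.

Local Open Scope classical_set_scope.
Local Open Scope ring_scope.

Section variable_exponent.
Context {R : realType}.
Notation mu := (@lebesgue_measure R).
Implicit Types (p s w f : R -> R) (q : R).

Definition variable_exponent p :=
  measurable_fun [set: R] p /\ forall x, 1 <= p x.

(* At x = y the first bound reads 0 <= C, because 0^-1 = 0 and ln e = 1. *)
Definition log_hoelder_exponent p :=
  variable_exponent p /\
  exists C pinf : R, [/\ 0 < C, 1 < pinf,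
    forall x y, `|p x - p y| <= C / ln (expR 1 + `|x - y|^-1) &
    forall x, `|p x - pinf| <= C / ln (expR 1 + `|x|)].

Definition weight w :=
  locally_integrable [set: R] w /\ forall x, 0 < w x.

(* Norms act on extended-real functions so that they apply to the maximal
   function, which may take the value +oo. *)
Definition luxemburg_norm (D : set R) s (g : R -> \bar R) : \bar R :=
  ereal_inf [set lam%:E | lam in
    [set lam : R | 0 < lam /\
       (\int[mu]_(x in D) ((`|g x| / lam%:E) `^ s x) <= 1)%E]].

Definition wnorm p w (g : R -> \bar R) : \bar R :=
  luxemburg_norm [set: R] p (fun x => (g x * (w x `^ (p x)^-1)%:E)%E).

(* Function spaces are sets of Borel representatives, without passing to the
   quotient by a.e. equality: the norms do not see null sets, so they are
   seminorms here. *)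
Definition weighted_space p w : set (R -> R) :=
  [set f | measurable_fun [set: R] f /\ (wnorm p w (EFin \o f) < +oo)%E].

(* The inverse is junk where p x = 1, where the conjugate exponent is
   infinite. *)
Definition conjugate_exponent p (x : R) : R := (1 - (p x)^-1)^-1.

Definition mean_exponent p (B : set R) : R :=
  ((fine (mu B))^-1 * \int[mu]_(x in B) (p x)^-1)^-1.

Definition muckenhoupt_average p w (B : set R) : \bar R :=
  ((fine (mu B) `^ (- mean_exponent p B))%:E
   * \int[mu]_(x in B) `|w x|%:E
   * luxemburg_norm B (fun x => conjugate_exponent p x / p x)%R
                      (fun x => ((w x)^-1)%:E)%R)%E.

Definition muckenhoupt p w :=
  (ereal_sup [set muckenhoupt_average p w (ball c.1 c.2)
             | c in [set c : R * R | (0 < c.2)%R]] < +oo)%E.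

Definition weighted_space_loc p w : set (R -> R) :=
  [set f | forall K, compact K -> weighted_space p w (f \* \1_K)].

Definition unit_interval (k : int) : set R := `[k%:~R, (k + 1)%:~R[.

Definition amalgam_norm p w q (g : R -> \bar R) : \bar R :=
  ((\esum_(k in [set: int])
     wnorm p w (fun x => g x * (\1_(unit_interval k) x)%:E) `^ q)
   `^ q^-1)%E.

Definition amalgam p w q : set (R -> R) :=
  [set f | weighted_space_loc p w f /\
           (amalgam_norm p w q (EFin \o f) < +oo)%E].

Definition HL_maximal_bounded p w q :=
  exists C : R, forall f, amalgam p w q f ->
    (amalgam_norm p w q (HL_maximal f)
      <= C%:E * amalgam_norm p w q (EFin \o f))%E.

Definition mollifier (phi : R -> R) :=
  [/\ forall n x, derivable (derive1n n phi) x 1,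
      forall x, 0 <= phi x,
      (forall x y, `|x| = `|y| -> phi x = phi y) /\
      (forall x y, `|x| <= `|y| -> phi y <= phi x),
      forall x, 1 <= `|x| -> phi x = 0 &
      (\int[mu]_x (phi x)%:E = 1)%E].

Definition dilation (phi : R -> R) (e x : R) : R := e^-1 * phi (x / e).

(* The real-valued integral is 0 by convention when the integrand is not
   integrable. *)
Definition convolution (phi f : R -> R) (x : R) : R :=
  \int[mu]_y (phi (x - y) * f y).

(* The points of the net are taken in the ambient space, not only in F. *)
Definition amalgam_totally_bounded p w q (F : set (R -> R)) :=
  forall e : R, 0 < e -> exists G : set (R -> R),
    [/\ finite_set G, G `<=` amalgam p w q &
        forall f, F f -> exists2 g, G g &
          (amalgam_norm p w q (EFin \o (f \- g)%R) < e%:E)%E].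

End variable_exponent.

(* Main.v *)
Require Import Defs.
From mathcomp Require Import all_boot all_order all_algebra finmap.
From mathcomp Require Import all_classical all_reals all_analysis ess_sup_inf measurable_realfun.
From mathcomp Require Import lra ring.
Import Order.TTheory GRing.Theory Num.Theory.
Import numFieldNormedType.Exports.
Local Open Scope classical_set_scope.
Local Open Scope ring_scope.

Set Implicit Arguments.
Unset Strict Implicit.
Unset Printing Implicit Defensive.

(* The Muckenhoupt condition, used only through its finiteness on each ball,
   embeds the amalgam space continuously into L^1_loc.  Hence, for fixed eps,
   the mollified functions phi_eps * f with f in a bounded family are uniformly
   bounded and uniformly Lipschitz on compact sets, and under (ii) and (iii)
   coding them by rounded values on a finite grid gives a finite net.
   Conversely, |phi_eps * g| <= 2 phi(0) M g pointwise; with the boundedness of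
   M this controls the mollification uniformly on small balls of the space, and
   for a single g it supplies the majorant in a dominated convergence argument
   based on Lebesgue differentiation. *)

(** The triangle inequality is replaced throughout by a quasi-triangle inequality whose hypotheses
    are measurability and the pointwise bound |h| <= |f| + |g|. Each use for the amalgam norm costs
    a factor 8, the origin of the constants 8, 64 and 8^4. It holds for extended-real functions, so
    the maximal function enters without being shown finite. For sufficiency of the three conditions
    the net is chosen inside F: f - g is compared with phi_eps * f - phi_eps * g on a large interval
    and with the tails of f and g outside it, so membership of mollified functions in the space
    never has to be shown. Uniform closeness on the interval becomes closeness in norm because w is
    locally integrable, which gives indicators of bounded intervals a finite norm. The upper bound P
    of p makes a modular that is finite at one scale finite at every scale, as dominated convergence
    requires. *)

(** * The modular and the weighted Luxemburg quasi-norm *)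

Section modular.
Context {R : realType}.
Notation mu := (@lebesgue_measure R).
Variables (p w : R -> R).
Hypothesis mp : measurable_fun [set: R] p.
Hypothesis p_ge1 : forall x, 1 <= p x.
Hypothesis mw : measurable_fun [set: R] w.
Hypothesis w_gt0 : forall x, 0 < w x.
Implicit Types (f g h : R -> \bar R) (c lam : R).

(** The power p(x) cancels the exponent 1/p(x) of the weight, so the modular is an integral against
    w dx; [wnormE] records this. *)
Definition modular_density lam g x : \bar R :=
  ((`|g x| * (lam^-1)%:E) `^ p x * (w x)%:E)%E.

Definition modular lam g := (\int[mu]_x modular_density lam g x)%E.

Lemma modular_density_ge0 lam g x : (0 <= modular_density lam g x)%E.
Proof. by rewrite mule_ge0 ?poweR_ge0// lee_fin ltW. Qed.

Lemma poweR_le (x y : \bar R) (r : R) : 0 <= r -> (0 <= x)%E -> (x <= y)%E ->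
  (x `^ r <= y `^ r)%E.
Proof.
move=> r0 x0 xy; apply: gt0_ler_poweR => //; rewrite in_itv/= leey andbT//.
exact: le_trans xy.
Qed.

Lemma measurable_fun_powR (a b : R -> R) :
  measurable_fun [set: R] a -> measurable_fun [set: R] b ->
  measurable_fun [set: R] (fun x => a x `^ b x).
Proof.
move=> ma mb; rewrite /powR.
apply: measurable_fun_ifT.
- exact: measurable_fun_eqr.
- have -> : (fun x => (b x == 0)%:R) = (fun x => if b x == 0 then 1 else 0 : R).
    by apply/funext => x; case: ifP.
  by apply: measurable_fun_ifT => //; exact: measurable_fun_eqr.
- apply: measurableT_comp => //; apply: measurable_funM => //.
  exact: measurableT_comp.
Qed.

Lemma measurable_modular_density lam g : measurable_fun [set: R] g ->
  measurable_fun [set: R] (modular_density lam g).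
Proof.
move=> mg; apply: emeasurable_funM; last exact/measurable_EFinP.
set a := (fun x => `|g x| * (lam^-1)%:E)%E.
have ma : measurable_fun [set: R] a.
  by apply: emeasurable_funM => //; exact: measurableT_comp.
(* The exponent varies with x, so the extended power is split by the infinite values of its base. As
   p x is nonzero, these give the constants +oo and 0. *)
have -> : (fun x => (`|g x| * (lam^-1)%:E) `^ p x)%E =
  (fun x => if a x == +oo then +oo else if a x == -oo then 0
            else ((fine (a x)) `^ p x)%:E)%E.
  apply/funext => x; rewrite -/(a x).
  have p0 : (p x == 0) = false.
    by apply/negbTE; rewrite gt_eqF// (lt_le_trans ltr01).
  by case: (a x) => [r| |] //=; rewrite p0.
apply: measurable_fun_ifT => //.
  exact: measurable_fun_eqe.
apply: measurable_fun_ifT => //.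
  exact: measurable_fun_eqe.
apply/measurable_EFinP; apply: measurable_fun_powR => //.
exact: measurableT_comp.
Qed.

Lemma modular_density_scale lam c f g x : 0 < lam -> 0 < c ->
  (`|f x| <= c%:E * `|g x|)%E ->
  (modular_density (c * lam) f x <= modular_density lam g x)%E.
Proof.
move=> lam0 c0 fg; rewrite lee_wpmul2r ?lee_fin ?(ltW (w_gt0 x))//.
apply: poweR_le.
- exact: le_trans (p_ge1 x).
- by rewrite mule_ge0// lee_fin invr_ge0 mulr_ge0 ?ltW.
- rewrite invfM EFinM muleA; apply: lee_wpmul2r.
    by rewrite lee_fin invr_ge0 ltW.
  by rewrite lee_pdivrMr// muleC.
Qed.

Lemma modular_density_powR lam c g x : 0 < lam -> 0 < c ->
  modular_density (c * lam) g x
  = ((c^-1 `^ p x)%:E * modular_density lam g x)%E.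
Proof.
move=> lam0 c0; rewrite /modular_density invfM EFinM muleCA (@poweRM _ (c^-1)%:E)//.
- by rewrite poweR_EFin muleA.
- by rewrite lee_fin invr_ge0 ltW.
- by rewrite mule_ge0// lee_fin invr_ge0 ltW.
Qed.

(** For c >= 1 and p >= 1 one has c^-p <= c^-1. This yields both the monotonicity of the modular in
    [lam] and its halving. *)
Lemma modular_density_expand lam c g x : 0 < lam -> 1 <= c ->
  (modular_density (c * lam) g x <= (c^-1)%:E * modular_density lam g x)%E.
Proof.
move=> lam0 c1; have c0 : 0 < c := lt_le_trans ltr01 c1.
rewrite modular_density_powR// lee_wpmul2r ?modular_density_ge0// lee_fin.
by rewrite ge1r_powR// invr_gt0 c0/= invf_le1.
Qed.

(** A doubling condition: c^p <= c^P controls the modular at smaller scales by the one at [lam]. *)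
Lemma modular_density_shrink (P : R) lam c g x : p x <= P -> 0 < lam -> 1 <= c ->
  (modular_density (lam / c) g x <= (c `^ P)%:E * modular_density lam g x)%E.
Proof.
move=> pP lam0 c1; have c0 : 0 < c := lt_le_trans ltr01 c1.
rewrite mulrC modular_density_powR// ?invr_gt0//.
by rewrite lee_wpmul2r ?modular_density_ge0// lee_fin invrK ler_powR.
Qed.

(** Pointwise |h| is at most twice the larger of |f| and |g|, and the scale 2 * lam absorbs the
    2. *)
Lemma modular_density_add lam f g h x : 0 < lam ->
  (`|h x| <= `|f x| + `|g x|)%E ->
  (modular_density (2 * lam) h x
    <= modular_density lam f x + modular_density lam g x)%E.
Proof.
move=> lam0 hfg.
have two k : (`|h x| <= 2%:E * `|k x| ->
    modular_density (2 * lam) h x <= modular_density lam k x)%E.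
  exact: modular_density_scale.
have [fg|gf] := leP `|f x|%E `|g x|%E.
  rewrite (le_trans (two g _)) ?leeDr ?modular_density_ge0//.
  by rewrite (le_trans hfg)// mule_natl mule2n leeD2r.
rewrite (le_trans (two f _)) ?leeDl ?modular_density_ge0//.
by rewrite (le_trans hfg)// mule_natl mule2n leeD2l// ltW.
Qed.

Lemma wnormE g : wnorm p w g = ereal_inf [set lam%:E | lam in
  [set lam | 0 < lam /\ (modular lam g <= 1)%E]].
Proof.
rewrite /wnorm /luxemburg_norm; congr ereal_inf; congr image.
apply/funext => lam; apply/propext.
have E : 0 < lam -> modular lam g = (\int[mu]_x
   (((`|g x * (w x `^ (p x)^-1)%:E| / lam%:E) `^ p x)))%E.
  move=> lam0; apply: eq_integral => x _; rewrite /modular_density.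
  rewrite abseM inver gt_eqF// muleAC [in RHS]poweRM//; last first.
    by rewrite mule_ge0// lee_fin invr_ge0 ltW.
  congr (_ * _)%E; rewrite /= ger0_norm ?powR_ge0// -powRrM mulVf ?powRr1 ?ltW//.
  by rewrite gt_eqF// (lt_le_trans ltr01).
by split=> -[l0] mle; split=> //=; move: mle; rewrite E.
Qed.

Lemma wnorm_ge0 g : (0 <= wnorm p w g)%E.
Proof.
by rewrite wnormE; apply/ereal_infP => _ [l [l0 _] <-]; rewrite lee_fin ltW.
Qed.

Lemma wnorm_le g lam : 0 < lam -> (modular lam g <= 1)%E ->
  (wnorm p w g <= lam%:E)%E.
Proof. by move=> l0 ml; rewrite wnormE; apply: ereal_inf_lbound; exists lam. Qed.

(** Some admissible l lies below [lam], and the modular does not increase when the scale grows from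
    l to [lam]. *)
Lemma wnorm_lt g lam : measurable_fun [set: R] g ->
  (wnorm p w g < lam%:E)%E -> 0 < lam /\ (modular lam g <= 1)%E.
Proof.
move=> mg; rewrite wnormE => /ereal_inf_lt[_ [l [l0 ml] <-]]; rewrite lte_fin => ll.
split; first exact: lt_trans ll.
apply: le_trans ml; apply: ge0_le_integral => //.
- by move=> x _; exact: modular_density_ge0.
- exact: measurable_modular_density.
- exact: measurable_modular_density.
- move=> x _; have -> : lam = (lam / l) * l by rewrite divfK// gt_eqF.
  have c1 : 1 <= lam / l by rewrite ler_pdivlMr// mul1r ltW.
  apply: le_trans (modular_density_expand _ _ l0 c1) _.
  rewrite gee_pMl ?modular_density_ge0//.
  by rewrite lee_fin invf_le1// (lt_le_trans ltr01).
Qed.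

Lemma wnorm_scale c f g : measurable_fun [set: R] f ->
  measurable_fun [set: R] g -> 0 < c -> (forall x, (`|f x| <= c%:E * `|g x|)%E) ->
  (wnorm p w f <= c%:E * wnorm p w g)%E.
Proof.
move=> mf mg c0 fg; rewrite -lee_pdivrMl//; rewrite [leRHS]wnormE.
apply/ereal_infP => _ [l [l0 ml] <-]; rewrite lee_pdivrMl//.
apply: wnorm_le; first exact: mulr_gt0.
apply: le_trans ml; apply: ge0_le_integral => //.
- by move=> x _; exact: modular_density_ge0.
- exact: measurable_modular_density.
- exact: measurable_modular_density.
- by move=> x _; exact: modular_density_scale.
Qed.

(* As p >= 1, doubling lam at least halves the modular; this replaces the
   convexity of the modular, at the price of the constant 4. *)
Lemma wnorm_quasi_triangle f g h : measurable_fun [set: R] f ->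
  measurable_fun [set: R] g -> measurable_fun [set: R] h ->
  (forall x, (`|h x| <= `|f x| + `|g x|)%E) ->
  (wnorm p w h <= 4%:E * maxe (wnorm p w f) (wnorm p w g))%E.
Proof.
move=> mf mg mh hfg; rewrite -lee_pdivrMl//.
(* The infimum need not be attained; the slack e gives strict bounds, from which [wnorm_lt] extracts
   modular bounds. *)
apply/lee_addgt0Pr => _ /posnumP[e].
set M := maxe _ _.
have [Mfin|] := boolP (M \is a fin_num); last first.
  have : (0 <= M)%E by rewrite le_max wnorm_ge0.
  by case: M => // _ _; rewrite leey.
have lM k : (wnorm p w k <= M -> wnorm p w k < (fine M + e%:num)%:E)%E.
  by move=> kM; apply: le_lt_trans kM _; rewrite EFinD fineK// lteDl// lte_fin.
have [m0 mod_f] := wnorm_lt mf (lM f ltac:(by rewrite le_max lexx)).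
have [_ mod_g] := wnorm_lt mg (lM g ltac:(by rewrite le_max lexx orbT)).
set m := fine M + e%:num in m0 mod_f mod_g *.
rewrite lee_pdivrMl// -(fineK Mfin) -EFinD -/m -EFinM.
apply: wnorm_le; first by rewrite mulr_gt0.
have intm k : measurable_fun [set: R] k ->
    (modular (2 * m) k <= (2^-1)%:E * modular m k)%E.
  move=> mk; rewrite -ge0_integralZl//; first last.
  - by move=> x _; exact: modular_density_ge0.
  - exact: measurable_modular_density.
  apply: ge0_le_integral => //.
  - by move=> x _; exact: modular_density_ge0.
  - exact: measurable_modular_density.
  - by apply: measurable_funeM; exact: measurable_modular_density.
  - by move=> x _; apply: modular_density_expand => //; rewrite ler1n.
have -> : 4 * m = 2 * (2 * m) by rewrite mulrA -natrM.
apply: (@le_trans _ _ (modular (2 * m) f + modular (2 * m) g)%E).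
  rewrite -ge0_integralD//.
  - apply: ge0_le_integral => //.
    + by move=> x _; exact: modular_density_ge0.
    + exact: measurable_modular_density.
    + by apply: emeasurable_funD; exact: measurable_modular_density.
    + by move=> x _; apply: modular_density_add => //; rewrite mulr_gt0.
  - by move=> x _; exact: modular_density_ge0.
  - exact: measurable_modular_density.
  - by move=> x _; exact: modular_density_ge0.
  - exact: measurable_modular_density.
have half k : measurable_fun [set: R] k -> (modular m k <= 1)%E ->
    (modular (2 * m) k <= (2^-1)%:E)%E.
  move=> mk kle; apply: le_trans (intm _ mk) _.
  by rewrite -[leRHS]mule1 lee_wpmul2l.
apply: (le_trans (leeD (half _ mf mod_f) (half _ mg mod_g))).
by rewrite -EFinD lee_fin; lra.
Qed.
End modular.

(** * Sums of nonnegative extended reals over arbitrary index sets *)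

Section esum_lemmas.
Context {R : realType} {T : choiceType}.
Implicit Types (a : T -> \bar R).

Lemma esumZ_le (A : set T) a (c : R) : 0 <= c -> (forall i, (0 <= a i)%E) ->
  (\esum_(i in A) (c%:E * a i) <= c%:E * \esum_(i in A) a i)%E.
Proof.
move=> c0 a0; apply: ge_ereal_sup => _ [X XA <-].
rewrite -ge0_mule_fsumr// lee_wpmul2l//.
by apply: ereal_sup_ubound; exists X.
Qed.

Lemma esum_term_le a i : (forall i, (0 <= a i)%E) ->
  (a i <= \esum_(i in [set: T]) a i)%E.
Proof.
move=> a0; apply: esum_ge; exists [set i]; last by rewrite fsbig_set1.
by split=> //; exact: finite_set1.
Qed.

(** A finite partial sum within e of the supremum leaves at most e for the complement; finiteness of
    the total permits the subtraction. *)
Lemma esum_tail a (e : R) : (forall i, (0 <= a i)%E) -> 0 < e ->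
  (\esum_(i in [set: T]) a i < +oo)%E ->
  exists2 X : set T, finite_set X & (\esum_(i in ~` X) a i <= e%:E)%E.
Proof.
move=> a0 e0 aoo.
have afin : \esum_(i in [set: T]) a i \is a fin_num.
  by rewrite ge0_fin_numE// esum_ge0.
have [_ [X [finX _] <-]] := ub_ereal_sup_adherent e0 afin.
rewrite -/(esum _ _) => lX; exists X => //.
move: lX; rewrite -esum_fset// (esumID X setT a)// !setTI.
move: afin; rewrite (esumID X setT a)// !setTI fin_numD => /andP[].
case: (\esum_(i in X) _) => [x| |]//= _; case: (\esum_(i in ~` _) _) => [y| |]//= _.
by rewrite -?EFinB -?EFinD lte_fin lee_fin; lra.
Qed.
End esum_lemmas.

(** * Order, scaling and quasi-triangle inequality for the amalgam norm *)

Section amalgam_norm.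
Context {R : realType}.
Notation mu := (@lebesgue_measure R).
Variables (p w : R -> R) (q : R).
Hypothesis mp : measurable_fun [set: R] p.
Hypothesis p_ge1 : forall x, 1 <= p x.
Hypothesis mw : measurable_fun [set: R] w.
Hypothesis w_gt0 : forall x, 0 < w x.
Hypothesis q_ge1 : 1 <= q.
Implicit Types (f g h : R -> \bar R) (c lam : R).

Definition block_norm g (k : int) : \bar R :=
  wnorm p w (fun x => g x * (\1_(unit_interval k) x)%:E)%E.

Let q_gt0 : 0 < q := lt_le_trans ltr01 q_ge1.

Lemma poweR_le_inv (x y : \bar R) : (0 <= x)%E -> (0 <= y)%E ->
  (x `^ q <= y `^ q)%E -> (x <= y)%E.
Proof.
move=> x0 y0 /(@poweR_le R _ _ q^-1 _ (poweR_ge0 _ _)).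
rewrite -!poweRrM mulfV ?gt_eqF// !poweRe1//.
by apply; rewrite invr_ge0 ltW.
Qed.

Lemma block_norm_ge0 g k : (0 <= block_norm g k)%E.
Proof. exact: wnorm_ge0. Qed.

Lemma measurable_block g k : measurable_fun [set: R] g ->
  measurable_fun [set: R] (fun x => g x * (\1_(unit_interval k : set R) x)%:E)%E.
Proof.
move=> mg; apply: emeasurable_funM => //; apply/measurable_EFinP.
by apply: measurable_indic; exact: measurable_itv.
Qed.

Lemma block_norm_scale c f g k : measurable_fun [set: R] f ->
  measurable_fun [set: R] g -> 0 < c -> (forall x, (`|f x| <= c%:E * `|g x|)%E) ->
  (block_norm f k <= c%:E * block_norm g k)%E.
Proof.
move=> mf mg c0 fg; apply: wnorm_scale => //; try exact: measurable_block.
by move=> x; rewrite !abseM muleA lee_wpmul2r.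
Qed.

Lemma block_norm_quasi_triangle f g h k : measurable_fun [set: R] f ->
  measurable_fun [set: R] g -> measurable_fun [set: R] h ->
  (forall x, (`|h x| <= `|f x| + `|g x|)%E) ->
  (block_norm h k <= 4%:E * maxe (block_norm f k) (block_norm g k))%E.
Proof.
move=> mf mg mh hfg; apply: wnorm_quasi_triangle => //; try exact: measurable_block.
by move=> x; rewrite !abseM -ge0_muleDl// lee_wpmul2r.
Qed.

Lemma amalgam_norm_ge0 g : (0 <= amalgam_norm p w q g)%E.
Proof. exact: poweR_ge0. Qed.

Lemma amalgam_norm_powR g : (amalgam_norm p w q g `^ q)%E =
  (\esum_(k in [set: int]) (block_norm g k `^ q))%E.
Proof.
rewrite /amalgam_norm -poweRrM mulVf ?gt_eqF// poweRe1//.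
by apply: esum_ge0 => k _; exact: poweR_ge0.
Qed.

Lemma amalgam_norm_ltP g (m : R) : 0 < m ->
  (amalgam_norm p w q g < m%:E)%E <->
  (\esum_(k in [set: int]) (block_norm g k `^ q) < (m `^ q)%:E)%E.
Proof.
move=> m0; rewrite -amalgam_norm_powR.
have := amalgam_norm_ge0 g; case: (amalgam_norm _ _ _ _) => [r| |]//=; last first.
  by rewrite gt_eqF// !ltNge !leey.
rewrite !lte_fin lee_fin => r0; split=> h.
  by rewrite gt0_ltr_powR// nnegrE// ltW.
by rewrite ltNge; apply/negP => mr; move: h; rewrite ltNge ge0_ler_powR// ?nnegrE// ltW.
Qed.

Lemma amalgam_norm_leP g (M : \bar R) : (0 <= M)%E ->
  (amalgam_norm p w q g <= M)%E <->
  (\esum_(k in [set: int]) (block_norm g k `^ q) <= M `^ q)%E.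
Proof.
move=> M0; rewrite -amalgam_norm_powR; split=> h.
  exact: (poweR_le (ltW q_gt0) (amalgam_norm_ge0 _) h).
by apply: poweR_le_inv h => //; exact: amalgam_norm_ge0.
Qed.

Lemma block_norm_le_amalgam g k : (block_norm g k <= amalgam_norm p w q g)%E.
Proof.
have h : (block_norm g k `^ q <= amalgam_norm p w q g `^ q)%E.
  rewrite amalgam_norm_powR.
  by apply: (@esum_term_le _ _ (fun k => block_norm g k `^ q)%E) => i; exact: poweR_ge0.
apply: poweR_le_inv h => //; first exact: block_norm_ge0.
exact: amalgam_norm_ge0.
Qed.

Lemma amalgam_norm_scale c f g : measurable_fun [set: R] f ->
  measurable_fun [set: R] g -> 0 < c -> (forall x, (`|f x| <= c%:E * `|g x|)%E) ->
  (amalgam_norm p w q f <= c%:E * amalgam_norm p w q g)%E.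
Proof.
move=> mf mg c0 fg; apply/amalgam_norm_leP.
  by rewrite mule_ge0 ?amalgam_norm_ge0// lee_fin ltW.
rewrite poweRM ?amalgam_norm_ge0//; last by rewrite lee_fin ltW.
rewrite amalgam_norm_powR.
apply: le_trans (esumZ_le _ (powR_ge0 c q) (fun=> poweR_ge0 _ _)).
apply: le_esum => k _; rewrite -poweR_EFin -poweRM ?block_norm_ge0//; last first.
  by rewrite lee_fin ltW.
apply: poweR_le; first exact: ltW.
  exact: block_norm_ge0.
exact: block_norm_scale.
Qed.

Lemma amalgam_norm_mono f g : measurable_fun [set: R] f ->
  measurable_fun [set: R] g -> (forall x, (`|f x| <= `|g x|)%E) ->
  (amalgam_norm p w q f <= amalgam_norm p w q g)%E.
Proof.
move=> mf mg fg; rewrite -[leRHS]mul1e.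
by apply: amalgam_norm_scale => // x; rewrite mul1e.
Qed.

(** The blockwise constant 4 becomes 8: the q-th power of a maximum is at most the sum of the q-th
    powers, and the resulting factor 2 is at most 2^q. *)
Lemma amalgam_norm_quasi_triangle f g h : measurable_fun [set: R] f ->
  measurable_fun [set: R] g -> measurable_fun [set: R] h ->
  (forall x, (`|h x| <= `|f x| + `|g x|)%E) ->
  (amalgam_norm p w q h
    <= 8%:E * maxe (amalgam_norm p w q f) (amalgam_norm p w q g))%E.
Proof.
move=> mf mg mh hfg; set M := maxe _ _.
have M0 : (0 <= M)%E by rewrite le_max; apply/orP; left; exact: amalgam_norm_ge0.
have q0 := ltW q_gt0.
apply/amalgam_norm_leP; first by rewrite mule_ge0.
apply: (@le_trans _ _ (\esum_(k in [set: int]) ((4 `^ q)%:E *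
    (block_norm f k `^ q + block_norm g k `^ q)))%E).
  apply: le_esum => k _.
  apply: (le_trans (poweR_le q0 (block_norm_ge0 _ _)
     (block_norm_quasi_triangle k mf mg mh hfg))).
  rewrite poweRM//; last by rewrite le_max block_norm_ge0.
  rewrite poweR_EFin lee_wpmul2l ?lee_fin ?powR_ge0//.
  by rewrite /maxe; case: ifP => _; rewrite ?leeDl ?leeDr ?poweR_ge0.
apply: le_trans (esumZ_le _ (powR_ge0 4 q) _) _.
  by move=> k; rewrite adde_ge0 ?poweR_ge0.
rewrite esumD; try by move=> k _; exact: poweR_ge0.
rewrite -!amalgam_norm_powR.
have le k : (amalgam_norm p w q k <= M)%E -> (amalgam_norm p w q k `^ q <= M `^ q)%E.
  by move=> kM; apply: poweR_le => //; exact: amalgam_norm_ge0.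
apply: (@le_trans _ _ ((4 `^ q)%:E * (M `^ q + M `^ q))%E).
  rewrite lee_wpmul2l ?lee_fin ?powR_ge0//.
  by apply: leeD; apply: le; rewrite /M le_max lexx ?orbT.
rewrite -mule2n -mule_natl muleA poweRM// lee_wpmul2r ?poweR_ge0//.
rewrite -EFinM poweR_EFin lee_fin.
have -> : 8 = 4 * 2 :> R by rewrite -natrM.
by rewrite powRM// ler_wpM2l ?powR_ge0// le1r_powR// ler1n.
Qed.
End amalgam_norm.

Lemma lebesgue_aeS {R : realType} (A B : R -> Prop) : (forall x, A x -> B x) ->
  {ae @lebesgue_measure R, forall x, A x} -> {ae @lebesgue_measure R, forall x, B x}.
Proof.
move=> AB [N [mN N0 subN]]; exists N; split=> // x nB; apply: subN => Ax.
by apply: nB; exact: AB.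
Qed.

Lemma cvge0_lt {R : realType} {T : Type} (F : set_system T) (u : T -> \bar R)
  (e : R) : Filter F -> u @ F --> 0%E -> 0 < e -> \forall n \near F, (u n < e%:E)%E.
Proof.
move=> FF cu e0; apply: (cu [set y | (y < e%:E)%E]); apply: open_nbhs_nbhs; split.
  exact: open_ereal_lt_ereal.
by rewrite /= lte_fin.
Qed.

(** * Dominated convergence in the weighted and amalgam norms *)

Section dominated_convergence.
Context {R : realType}.
Notation mu := (@lebesgue_measure R).
Variables (p w : R -> R) (q P : R).
Hypothesis mp : measurable_fun [set: R] p.
Hypothesis p_ge1 : forall x, 1 <= p x.
Hypothesis p_le : forall x, p x <= P.
Hypothesis mw : measurable_fun [set: R] w.
Hypothesis w_gt0 : forall x, 0 < w x.
Hypothesis q_ge1 : 1 <= q.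
Implicit Types (g : (R -> \bar R)^nat) (h : R -> \bar R) (lam : R).

Lemma modular_density_cvg0 lam g x : 0 < lam -> (g ^~ x) @ \oo --> 0%E ->
  (fun n => modular_density p w lam (g n) x) @ \oo --> 0%E.
Proof.
move=> lam0 gx0; have g0 : (fun n => `|g n x|%E) @ \oo --> 0%E.
  by rewrite -abse0; exact: cvg_abse gx0.
(* Once |g n x| < lam the base of the power is below 1, and p >= 1 bounds the power by its base;
   hence a majorant linear in |g n x|. *)
pose u n := (`|g n x| * (w x / lam)%:E)%E.
have u0 : u @ \oo --> 0%E.
  by rewrite -(mul0e (w x / lam)%:E); apply: cvgeZr.
apply: (@squeeze_cvge _ _ _ _ (fun=> 0%E) _ u) => //; last exact: cvg_cst.
have : \forall n \near \oo, (`|g n x| < lam%:E)%E.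
  exact: cvge0_lt g0 _.
apply: filterS => n gn; rewrite modular_density_ge0//=.
rewrite /u /modular_density mulrC EFinM muleA lee_wpmul2r ?lee_fin ?(ltW (w_gt0 x))//.
move: gn; have := abse_ge0 (g n x); case: (`|g n x|%E) => [r| |]//.
rewrite lee_fin lte_fin => r0 rl; rewrite -EFinM poweR_EFin lee_fin.
have [->|rn0] := eqVneq r 0.
  by rewrite mul0r powR0// gt_eqF// (lt_le_trans ltr01).
rewrite ge1r_powR//; apply/andP; split.
  by rewrite divr_gt0// lt_neqAle eq_sym rn0.
by rewrite ler_pdivrMr// mul1r ltW.
Qed.

(** It suffices that the modulars tend to 0 at one fixed scale lam <= e: as soon as they are below
    1, the norms are at most lam. *)
Lemma wnorm_dominated g h (e : R) :
  (forall n, measurable_fun [set: R] (g n)) -> measurable_fun [set: R] h ->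
  (forall n x, (`|g n x| <= `|h x|)%E) ->
  {ae mu, forall x, (g ^~ x) @ \oo --> 0%E} ->
  (wnorm p w h < +oo)%E -> 0 < e ->
  \forall n \near \oo, (wnorm p w (g n) <= e%:E)%E.
Proof.
move=> mg mh gh g0 hoo e0.
have [l l0 ml] : exists2 l : R, 0 < l & (modular p w l h <= 1)%E.
  have hfin : wnorm p w h \is a fin_num by rewrite ge0_fin_numE// wnorm_ge0.
  have : (wnorm p w h < (fine (wnorm p w h) + 1)%:E)%E.
    by rewrite EFinD fineK// lteDl.
  by move=> /(wnorm_lt mp p_ge1 mw w_gt0 mh)[]; exists (fine (wnorm p w h) + 1).
(* c >= l / e gives l / c <= e, and c >= 1 allows [modular_density_shrink] to make the density of h
   integrable at the scale l / c. *)
pose c := Num.max 1 (l / e).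
have c1 : 1 <= c by rewrite le_max lexx.
have c0 : 0 < c := lt_le_trans ltr01 c1.
pose lam := l / c.
have lam0 : 0 < lam by rewrite divr_gt0.
have lame : lam <= e.
  by rewrite ler_pdivrMr// mulrC -ler_pdivrMr// le_max lexx orbT.
have mdm n : measurable_fun [set: R] (modular_density p w lam (g n)).
  exact: measurable_modular_density.
have ih : mu.-integrable [set: R] (modular_density p w lam h).
  apply/integrableP; split; first exact: measurable_modular_density.
  apply: (@le_lt_trans _ _ ((c `^ P)%:E * modular p w l h)%E); last first.
    rewrite lte_mul_pinfty ?lee_fin ?powR_ge0//.
    exact: le_lt_trans ml (ltry _).
  rewrite -ge0_integralZl//; first last.
  - by rewrite lee_fin powR_ge0.
  - by move=> x _; exact: modular_density_ge0.
  - exact: measurable_modular_density.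
  apply: ge0_le_integral => //.
  - apply: measurableT_comp => //; exact: measurable_modular_density.
  - by apply: measurable_funeM; exact: measurable_modular_density.
  - move=> x _; rewrite gee0_abs ?modular_density_ge0//.
    exact: modular_density_shrink.
have [] := @dominated_convergence _ _ _ mu setT measurableT
  (fun n => modular_density p w lam (g n)) (cst 0%E) _ mdm
  (measurable_cst _) _ ih _.
- apply: lebesgue_aeS g0 => x gx _; exact: modular_density_cvg0.
- apply: aeW => x n _; rewrite gee0_abs ?modular_density_ge0//.
  rewrite -[lam]mul1r.
  by apply: le_trans (modular_density_scale p_ge1 w_gt0 (c := 1) lam0 _ _) _ => //;
    rewrite ?mul1e ?mul1r.
- move=> _ _; rewrite integral0 => cv.
  have : \forall n \near \oo, (modular p w lam (g n) < 1)%E.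
    exact: cvge0_lt cv _.
  apply: filterS => n /ltW mn; apply: le_trans (wnorm_le _ _ lam0 mn) _ => //.
Qed.

Lemma amalgam_norm_dominated g h (e : R) :
  (forall n, measurable_fun [set: R] (g n)) -> measurable_fun [set: R] h ->
  (forall n x, (`|g n x| <= `|h x|)%E) ->
  {ae mu, forall x, (g ^~ x) @ \oo --> 0%E} ->
  (amalgam_norm p w q h < +oo)%E -> 0 < e ->
  \forall n \near \oo, (amalgam_norm p w q (g n) < e%:E)%E.
Proof.
move=> mg mh gh g0 hoo e0.
have q0 : 0 < q := lt_le_trans ltr01 q_ge1.
have eq0 : 0 < e `^ q by rewrite powR_gt0.
(* The tail and the finite part contribute at most eta each, in total e^q / 2 < e^q. Outside the
   finite set the blocks of g n are bounded by those of h. *)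
pose eta := e `^ q / 4.
have eta0 : 0 < eta by rewrite divr_gt0.
have hq k : (0 <= block_norm p w h k `^ q)%E by exact: poweR_ge0.
have hoo' : (\esum_(k in [set: int]) block_norm p w h k `^ q < +oo)%E.
  by rewrite -amalgam_norm_powR// poweR_lty.
have [X /finite_fsetP[D ->] tailX] := esum_tail hq eta0 hoo'.
(* Each block in D contributes at most d^q; the successor in the denominator covers an empty D. *)
pose d := (eta / (size (finmap.enum_fset D)).+1%:R) `^ q^-1.
have d0 : 0 < d by rewrite powR_gt0// divr_gt0.
have near_block k : \forall n \near \oo, (block_norm p w (g n) k <= d%:E)%E.
  apply: (@wnorm_dominated _ (fun x => h x * (\1_(unit_interval k) x)%:E)%E) => //.
  - by move=> n; exact: measurable_block.
  - exact: measurable_block.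
  - by move=> n x; rewrite !abseM lee_wpmul2r.
  - apply: lebesgue_aeS g0 => x gx; rewrite -(mul0e (\1_(unit_interval k : set R) x)%:E).
    exact: cvgeZr.
  - exact: le_lt_trans (block_norm_le_amalgam _ _ q_ge1 _ _) hoo.
have near_all : \forall n \near \oo, forall k, k \in D -> (block_norm p w (g n) k <= d%:E)%E.
  have : nbhs (\oo : set_system nat)
      (\bigcap_(k in [set` D]) [set n | (block_norm p w (g n) k <= d%:E)%E]).
    by apply: filter_bigI => k _; exact: near_block.
  by apply: filterS => n nD k kD; exact: nD.
apply: filterS near_all => n nD.
apply/amalgam_norm_ltP => //.
rewrite (esumID [set` D]) ?setTI; last by move=> k _; exact: poweR_ge0.
apply: (@le_lt_trans _ _ (eta%:E + eta%:E)%E); last first.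
  by rewrite -EFinD lte_fin /eta; lra.
apply: leeD; last first.
  apply: le_trans tailX; apply: le_esum => k _; apply: poweR_le; first exact: ltW.
    exact: block_norm_ge0.
  apply: le_trans (block_norm_scale mp p_ge1 mw w_gt0 k (c:=1) (f := g n) (g := h) _ _ _ _) _ => //.
    by move=> x; rewrite mul1e.
  by rewrite mul1e.
rewrite esum_fset//; last by move=> k _; exact: poweR_ge0.
rewrite fsbig_finite//= set_fsetK.
apply: (@le_trans _ _ (\sum_(k <- finmap.enum_fset D) (d `^ q)%:E)%E).
  rewrite big_seq [leRHS]big_seq; apply: lee_sum => k kD.
  rewrite -poweR_EFin; apply: poweR_le; first exact: ltW.
    exact: block_norm_ge0.
  exact: nD.
rewrite sumEFin lee_fin big_const_seq count_predT iter_addr_0 -mulr_natr.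
rewrite /d -powRrM mulVf ?gt_eqF// powRr1; last by rewrite ltW// divr_gt0.
rewrite mulrAC ler_pdivrMr// ler_wpM2l//; first exact: ltW.
by rewrite ler_nat.
Qed.
End dominated_convergence.

(** * From the Muckenhoupt condition to integral bounds *)

Section muckenhoupt.
Context {R : realType}.
Notation mu := (@lebesgue_measure R).
Variables (p w : R -> R) (q : R).
Hypothesis mp : measurable_fun [set: R] p.
Hypothesis p_ge1 : forall x, 1 <= p x.
Hypothesis p_gt1 : {ae mu, forall x, 1 < p x}.
Hypothesis mw : measurable_fun [set: R] w.
Hypothesis w_gt0 : forall x, 0 < w x.
Hypothesis q_ge1 : 1 <= q.
Hypothesis w_muckenhoupt : muckenhoupt p w.
Implicit Types (f g h : R -> R) (lam : R).

(* The exponent is 1 / (p - 1), and 0 by convention where p = 1. *)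
Definition dual_weight lam x := ((w x)^-1 / lam) `^ (conjugate_exponent p x / p x).

Lemma measurable_dual_weight lam : measurable_fun [set: R] (dual_weight lam).
Proof.
have mV (u : R -> R) : (forall x, 0 <= u x) -> measurable_fun [set: R] u ->
    measurable_fun [set: R] (fun x => (u x)^-1).
  move=> u0 mu_; under eq_fun do rewrite -powR_inv1//.
  by apply: measurable_fun_powR.
have p0 x : 0 <= p x by rewrite (le_trans ler01).
have w0 x : 0 <= w x by exact: ltW.
apply: measurable_fun_powR; first by apply: measurable_funM => //; exact: mV.
apply: measurable_funM; last exact: mV.
apply: (mV _ _); last by apply: measurable_funB => //; exact: mV.
by move=> x; rewrite subr_ge0 invf_le1// (lt_le_trans ltr01).
Qed.

(** The product in the Muckenhoupt condition is finite and its first two factors are positive, so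
    the Luxemburg factor is not +oo and its infimum ranges over a nonempty set. *)
Lemma muckenhoupt_dual_weight (c r : R) : 0 < r -> exists2 lam : R, 0 < lam &
  (\int[mu]_(x in ball c r) (dual_weight lam x)%:E <= 1)%E.
Proof.
move=> r0.
have : (muckenhoupt_average p w (ball c r) < +oo)%E.
  apply: le_lt_trans w_muckenhoupt; apply: ereal_sup_ubound.
  by exists (c, r).
have mB : measurable (ball c r : set R) by exact: measurable_ball.
have muB : (mu (ball c r) = (r *+ 2)%:E)%E by rewrite lebesgue_measure_ball// ltW.
have r20 : 0 < r *+ 2 by rewrite mulrn_wgt0.
rewrite /muckenhoupt_average muB.
set a := (_ `^ _); have a0 : 0 < a by rewrite powR_gt0.
set I := (\int[mu]_(x in _) _)%E; set L := luxemburg_norm _ _ _.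
(* If the integral vanished, w would vanish almost everywhere on a ball of positive measure. *)
have I0 : (0 < I)%E.
  rewrite lt_neqAle integral_ge0// andbT eq_sym; apply/eqP => I0.
  have /ae_eq_integral_abs : (\int[mu]_(x in ball c r) `|(w x)%:E| = 0)%E by [].
  move=> /(_ mB) [|N [mN N0 sub]]; first exact/measurable_EFinP/measurable_funTS.
  have : (mu (ball c r) <= mu N)%E.
    apply: le_measure; rewrite ?inE// => x Bx; apply: sub => /(_ Bx)/=.
    by case => /eqP; rewrite gt_eqF.
  by rewrite muB N0 lee_fin leNgt r20.
move=> Loo; have {}Loo : (L < +oo)%E.
  have := leey L; rewrite le_eqVlt => /predU1P[LE|//].
  by move: Loo; rewrite LE gt0_muley// mule_gt0.
have [_ [lam [lam0 ile] <-] _] := ereal_inf_lt Loo.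
exists lam => //; apply: le_trans ile; rewrite le_eqVlt; apply/orP; left; apply/eqP.
apply: eq_integral => x _; rewrite inver gt_eqF//= ger0_norm ?invr_ge0 ?ltW//.
Qed.

(* Either |t| / m is at most the dual weight, or its power of exponent p - 1
   exceeds (lam * w)^-1. *)
Lemma le_dual_weight_modular lam (m t : R) x : 1 < p x -> 0 < lam -> 0 < m ->
  `|t| <= m * (dual_weight lam x + lam * ((`|t| / m) `^ p x * w x)).
Proof.
move=> p1 lam0 m0; rewrite -ler_pdivrMl// mulrC.
have p0 : 0 < p x := lt_trans ltr01 p1.
set s := `|t| / m; have s0 : 0 <= s by rewrite divr_ge0// ltW.
have [sv|vs] := leP s (dual_weight lam x).
  by rewrite (le_trans sv)// lerDl !mulr_ge0 ?powR_ge0// ltW.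
have v0 : 0 <= dual_weight lam x by exact: powR_ge0.
have sp : 0 < s by exact: le_lt_trans vs.
rewrite -[leLHS]add0r lerD//.
have p10 : 0 < p x - 1 by rewrite subr_gt0.
have : dual_weight lam x `^ (p x - 1) <= s `^ (p x - 1).
  by apply: ge0_ler_powR; rewrite ?nnegrE ?(ltW p10) ?(ltW vs).
rewrite /dual_weight -powRrM.
have -> : conjugate_exponent p x / p x * (p x - 1) = 1.
  by rewrite /conjugate_exponent; field; rewrite !gt_eqF.
rewrite powRr1; last by rewrite divr_ge0// ?invr_ge0 ltW.
rewrite -invfM => h.
have lw0 : 0 < w x * lam by rewrite mulr_gt0.
rewrite -mulr_powRB1//.
(* Splitting s^p as s times s^(p-1) isolates the factor w lam s^(p-1), which is at least 1 in this
   case. *)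
have -> : lam * (s * s `^ (p x - 1) * w x) = s * (w x * lam * s `^ (p x - 1)) by ring.
rewrite ler_peMr//; move: h; rewrite -[X in X <= _]mulr1 ler_pdivrMl//.
Qed.

(** Integrating [le_dual_weight_modular] takes the place of a Hoelder inequality for variable
    exponents; K depends on k and m but not on f. *)
Lemma block_integral_bound (k : int) (m : R) : 0 < m -> exists K : R,
  forall f, measurable_fun [set: R] f -> (block_norm p w (EFin \o f) k < m%:E)%E ->
    (\int[mu]_(x in unit_interval k) `|f x|%:E <= K%:E)%E.
Proof.
(* The ball of radius 2 about k contains [k, k+1). There the dual weight contributes at most 1 and
   the modular at most [lam], whence m (1 + lam). *)
move=> m0; have [lam lam0 Ilam] := @muckenhoupt_dual_weight k%:~R 2 ltac:(by []).
exists (m * (1 + lam)) => f mf fm.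
have mJ : measurable (unit_interval k : set R) by exact: measurable_itv.
pose g x := ((f x)%:E * (\1_(unit_interval k) x)%:E)%E.
have mg : measurable_fun [set: R] g.
  by apply: measurable_block; exact/measurable_EFinP.
have [_ gm] := wnorm_lt mp p_ge1 mw w_gt0 mg fm.
have mdw := measurable_dual_weight lam.
have mmd : measurable_fun [set: R] (modular_density p w m g).
  exact: measurable_modular_density.
have mlmd : measurable_fun [set: R] (fun x => lam%:E * modular_density p w m g x)%E.
  exact: measurable_funeM.
have mFm : measurable_fun [set: R] (fun x => (dual_weight lam x)%:E
    + lam%:E * modular_density p w m g x)%E.
  by apply: emeasurable_funD => //; exact/measurable_EFinP.
have md0 x : (0 <= modular_density p w m g x)%E by exact: modular_density_ge0.
pose F x := (m%:E * ((dual_weight lam x)%:E + lam%:E * modular_density p w m g x))%E.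
have mF : measurable_fun [set: R] F by exact: measurable_funeM.
have F0 x : (0 <= F x)%E.
  apply: mule_ge0; first by rewrite lee_fin ltW.
  apply: adde_ge0; first by rewrite lee_fin powR_ge0.
  by apply: mule_ge0 => //; rewrite lee_fin ltW.
apply: (@le_trans _ _ (\int[mu]_(x in unit_interval k) F x)%E).
  apply: ae_ge0_le_integral => //.
  - by apply: measurable_funTS; apply/measurable_EFinP; exact: measurableT_comp.
  - exact: (measurable_funTS mF).
  - apply: lebesgue_aeS p_gt1 => x p1 Jx.
    rewrite /F /modular_density /g indicE mem_set// mule1 /=.
    rewrite -!(EFinM, EFinD) lee_fin; exact: le_dual_weight_modular.
rewrite ge0_integralZl//; first last.
- by rewrite lee_fin ltW.
- move=> x _; apply: adde_ge0; first by rewrite lee_fin powR_ge0.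
  by apply: mule_ge0 => //; rewrite lee_fin ltW.
- by apply: measurable_funTS.
rewrite EFinM lee_wpmul2l ?lee_fin ?(ltW m0)//.
rewrite ge0_integralD//; first last.
- by apply: measurable_funTS.
- by move=> x _; rewrite mule_ge0// lee_fin ltW.
- exact/measurable_EFinP/measurable_funTS.
- by move=> x _; rewrite lee_fin powR_ge0.
rewrite EFinD; apply: leeD.
  apply: le_trans Ilam; apply: ge0_subset_integral => //.
  - exact: measurable_ball.
  - exact/measurable_EFinP/measurable_funTS.
  - by move=> x _; rewrite lee_fin powR_ge0.
  - move=> x; rewrite /unit_interval /= in_itv/= intrD => /andP[kx xk].
    by rewrite /ball/= ltr_norml; lra.
rewrite ge0_integralZl//; first last.
- by rewrite lee_fin ltW.
- by apply: measurable_funTS.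
rewrite -[leRHS]mule1 lee_wpmul2l ?lee_fin ?(ltW lam0)//.
by apply: le_trans gm; exact: ge0_subset_integral.
Qed.

Lemma amalgam_integral_bound (n : nat) (m : R) : 0 < m -> exists K : R,
  forall f, measurable_fun [set: R] f -> (amalgam_norm p w q (EFin \o f) < m%:E)%E ->
    (\int[mu]_(x in `[(- n%:R)%R, n%:R[) `|f x|%:E <= K%:E)%E.
Proof.
move=> m0; elim: n => [|n [K hK]].
  by exists 0 => f mf _; rewrite oppr0 set_itvco0 integral_set0.
have [K1 h1] := @block_integral_bound (Posz n) _ m0.
(* [Negz n] denotes -(n+1), whose unit interval is [-(n+1), -n); the two new blocks extend [-n, n)
   on both sides. *)
have [K2 h2] := @block_integral_bound (Negz n) _ m0.
exists (K + K1 + K2) => f mf fm.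
have bm k : (block_norm p w (EFin \o f) k < m%:E)%E.
  exact: le_lt_trans (block_norm_le_amalgam _ _ q_ge1 _ _) fm.
have mf' (D : set R) : measurable_fun D (fun x => `|f x|%:E).
  by apply: measurable_funTS; apply/measurable_EFinP; exact: measurableT_comp.
have := hK _ mf fm; have := h1 _ mf (bm _); have := h2 _ mf (bm _).
have -> : unit_interval (Posz n) = `[n%:R, n.+1%:R[%classic :> set R.
  by rewrite /unit_interval -PoszD addn1.
have -> : unit_interval (Negz n) = `[- n.+1%:R, - n%:R[%classic :> set R.
  rewrite /unit_interval NegzE (_ : - (n.+1)%:Z + 1 = - n%:Z) ?mulrNz//.
  by rewrite -addn1 PoszD opprD addrNK.
have -> : `[(- n.+1%:R), n.+1%:R[%classic = `[(- n%:R), n%:R[%classic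
    `|` `[n%:R, n.+1%:R[ `|` `[- n.+1%:R, - n%:R[ :> set R.
  rewrite -natr1; have n0 : 0 <= n%:R :> R by [].
  apply/seteqP; split => x /=; rewrite !in_itv/=.
    move=> /andP[h3 h4]; have [xn|xn] := ltP x n%:R; last by left; right; lra.
    by have [xn'|xn'] := ltP x (- n%:R); [right|left; left]; lra.
  by case=> [[|]|]; lra.
have n0 : 0 <= n%:R :> R by [].
move=> i2 i1 i0.
rewrite ge0_integral_setU//; first last.
- apply/disj_setPLR => x /=; rewrite !in_itv/= => -[] /andP[xn _]; apply/negP;
    rewrite negb_and -!leNgt; apply/orP; right; lra.
- exact: mf'.
- by apply: measurableU; exact: measurable_itv.
rewrite ge0_integral_setU//; first last.
- apply/disj_setPLR => x /=; rewrite !in_itv/= => /andP[_ xn]; apply/negP;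
    rewrite negb_and -!ltNge xn//.
- exact: mf'.
by rewrite !EFinD leeD// leeD.
Qed.
End muckenhoupt.

(** * Local integrability and interval indicators in the amalgam space *)

Section amalgam_space.
Context {R : realType}.
Notation mu := (@lebesgue_measure R).
Variables (p w : R -> R) (q : R).
Implicit Types (f g h : R -> R).

(** Since ln(e + |x|) >= 1, the decay condition bounds p by pinf + C at every point, not only almost
    everywhere. *)
Lemma log_hoelder_bounded : log_hoelder_exponent p -> exists P : R, forall x, p x <= P.
Proof.
move=> [_ [C [pinf [C0 _ _ hx]]]]; exists (pinf + C) => x.
have l1 : 1 <= ln (expR 1 + `|x|).
  have e0 : 0 < expR 1 + `|x| by rewrite ltr_pwDl ?expR_gt0.
  by rewrite -[leLHS](expRK 1) ler_ln ?posrE ?expR_gt0// lerDl.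
rewrite -lerBlDl (le_trans (ler_norm _))// (le_trans (hx x))//.
by rewrite ler_pdivrMr ?(lt_le_trans ltr01)// ler_peMr// ltW.
Qed.

Lemma ess_inf_gt1 : (1 < ess_inf mu (EFin \o p))%E -> {ae mu, forall x, 1 < p x}.
Proof.
move=> h; apply: lebesgue_aeS (ess_inf_le mu (EFin \o p)) => x px.
by rewrite -lte_fin; exact: lt_le_trans px.
Qed.

(** Membership speaks only of the truncations of f to compact sets, so f is glued from the intervals
    [-n, n]. *)
Lemma amalgam_measurable f : amalgam p w q f -> measurable_fun [set: R] f.
Proof.
move=> [floc _].
have E : \bigcup_n `[(- n%:R), n%:R]%classic = [set: R].
  apply/seteqP; split=> // x _; exists (Num.truncn `|x|).+1 => //=.
  by rewrite in_itv/= -ler_norml ltW// truncnS_gt.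
rewrite -E; apply/(measurable_fun_bigcup f) => [n|n]; first exact: measurable_itv.
have [mf _] := floc _ (@segment_compact R (- n%:R) n%:R).
apply: (@eq_measurable_fun _ _ _ _ _ (f \* \1_(`[(- n%:R), n%:R]%classic : set R))).
  by move=> x xn /=; rewrite indicE xn mulr1.
exact: measurable_funTS.
Qed.

Hypothesis mp : measurable_fun [set: R] p.
Hypothesis p_ge1 : forall x, 1 <= p x.
Hypothesis p_gt1 : {ae mu, forall x, 1 < p x}.
Hypothesis ww : weight w.
Hypothesis q_ge1 : 1 <= q.
Hypothesis w_muckenhoupt : muckenhoupt p w.

Let mw : measurable_fun [set: R] w. Proof. by case: ww => -[]. Qed.
Let w_gt0 x : 0 < w x. Proof. by case: ww => _ /(_ x). Qed.

Lemma amalgam_locally_integrable f : amalgam p w q f -> locally_integrable [set: R] f.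
Proof.
move=> ff; have mf := amalgam_measurable ff.
split => //; first exact: openT.
move=> K _ cK.
have [M M0 KM] : exists2 M : R, 0 < M & forall x, K x -> `|x| <= M.
  have [M [_ hM]] := compact_bounded cK.
  exists (Num.max 1 (M + 1)); first by rewrite lt_max ltr01.
  move=> x Kx; apply: (hM (Num.max 1 (M + 1))) => //.
  by rewrite lt_max ltrDl ltr01 orbT.
pose n := (Num.truncn M).+1.
case: ff => _ fN; have Nfin : amalgam_norm p w q (EFin \o f) \is a fin_num.
  by rewrite ge0_fin_numE// amalgam_norm_ge0.
pose m := fine (amalgam_norm p w q (EFin \o f)) + 1.
have m0 : 0 < m by rewrite ltr_wpDl// fine_ge0// amalgam_norm_ge0.
have fm : (amalgam_norm p w q (EFin \o f) < m%:E)%E.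
  by rewrite EFinD fineK// lteDl.
have [L hL] := @amalgam_integral_bound _ p w q mp p_ge1 p_gt1 mw w_gt0 q_ge1 w_muckenhoupt n m m0.
apply: le_lt_trans (ltry L); apply: le_trans (hL _ mf fm).
apply: ge0_subset_integral => //.
- by apply: closed_measurable; apply: compact_closed => //; exact: Rhausdorff.
- by apply: measurable_funTS; apply/measurable_EFinP; exact: measurableT_comp.
- move=> x Kx; rewrite /= in_itv/=; have := KM _ Kx; rewrite ler_norml => /andP[x1 x2].
  by have := truncnS_gt M; rewrite -/n; lra.
Qed.

(** At scale 1 the modular of the indicator is the integral of w over A; a scale c >= 1 above that
    integral brings it below 1. *)
Lemma wnorm_indic_lty (A : set R) : measurable A ->
  (\int[mu]_(x in A) (w x)%:E < +oo)%E ->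
  (wnorm p w (fun x => (\1_A x)%:E) < +oo)%E.
Proof.
move=> mA; set I := (\int[mu]_(x in A) _)%E => Ioo.
have I0 : (0 <= I)%E by apply: integral_ge0 => x _; rewrite lee_fin ltW.
have Ifin : I \is a fin_num by rewrite ge0_fin_numE.
have mwA : measurable_fun [set: R] ((fun x => (w x)%:E) \_ A).
  apply: (measurable_restrictT _ mA).1; apply: measurable_funTS.
  exact/measurable_EFinP.
have [c c1 cI] : exists2 c : R, 1 <= c & fine I <= c.
  by exists (Num.max 1 (fine I)); rewrite le_max lexx ?orbT.
have c0 : 0 < c := lt_le_trans ltr01 c1.
apply: le_lt_trans (ltry c); apply: wnorm_le => //.
apply: (@le_trans _ _ ((c^-1)%:E * I)%E); last first.
  by rewrite -(fineK Ifin) -EFinM lee_fin ler_pdivrMl// mulr1.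
rewrite /I integral_mkcond -ge0_integralZl//; first last.
- by rewrite lee_fin invr_ge0 ltW.
- by move=> x _; rewrite patchE; case: ifP => _ //; rewrite lee_fin ltW.
have m1 : measurable_fun [set: R] (fun x : R => (\1_A x)%:E : \bar R).
  by apply/measurable_EFinP; exact: measurable_indic.
apply: ge0_le_integral => //.
- by move=> x _; exact: modular_density_ge0.
- exact: measurable_modular_density.
- exact: measurable_funeM.
- move=> x _; rewrite patchE -[c]mulr1.
  apply: le_trans (modular_density_expand p_ge1 w_gt0 _ _ ltr01 c1) _.
  rewrite mulr1 lee_wpmul2l ?lee_fin ?invr_ge0 ?(ltW c0)//.
  rewrite /modular_density indicE invr1 mule1.
  case: ifPn => [_|_]; first by rewrite /= normr1 powR1 mul1e.
  by rewrite /= normr0 powR0 ?mul0e// gt_eqF// (lt_le_trans ltr01).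
Qed.

(** Only the blocks with -n <= k < n meet the interval, and each has finite norm since w is locally
    integrable. This turns a uniform bound on a bounded interval into a norm bound. *)
Lemma amalgam_indic_itv (n : nat) :
  (amalgam_norm p w q (fun x => (\1_(`[(- n%:R)%R, n%:R[) x)%:E) < +oo)%E.
Proof.
set A := `[(- n%:R)%R, n%:R[%classic.
suff : (\esum_(k in [set: int]) block_norm p w (fun x => (\1_A x)%:E) k `^ q < +oo)%E.
  by rewrite -amalgam_norm_powR//; apply: lty_poweRy; rewrite gt_eqF// (lt_le_trans ltr01).
pose D := [set k : int | (- n%:Z <= k < n%:Z)%R].
have finD : finite_set D.
  have DI : D `<=` (fun i : nat => i%:Z - n%:Z) @` `I_(n + n).
    move=> k /= /andP[k1 k2]; have kn : 0 <= k + n%:Z by rewrite -lerBlDr sub0r.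
    exists (absz (k + n%:Z)); last by rewrite gez0_abs// addrK.
    by rewrite -ltz_nat gez0_abs// PoszD ltrD2r.
  by apply: (sub_finite_set DI); apply: finite_image; exact: finite_II.
have zero k : ~ D k -> block_norm p w (fun x => (\1_A x)%:E) k = 0%E.
  move=> Dk; apply: le_anti; apply/andP; split; last exact: block_norm_ge0.
  (* On a block that misses the interval the modular is 0 at every scale, so every e > 0 is
     admissible. *)
  apply/lee_addgt0Pr => e e0; rewrite add0e; apply: wnorm_le => //.
  rewrite [leLHS](_ : _ = 0%E)//; apply: integral0_eq => x _.
  rewrite /modular_density -EFinM !indicE -natrM mulnb -in_setI memNset /=.
    by rewrite mulr0n normr0 mul0r powR0 ?mul0r// gt_eqF// (lt_le_trans ltr01).
  rewrite /A /unit_interval /= !in_itv/= => -[] /andP[x1 x2] /andP[k1 k2]; apply: Dk; rewrite /D /=.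
  rewrite -(ltr_int R) (le_lt_trans k1 x2) andbT.
  by rewrite -ltzD1 -(ltr_int R) mulrNz (le_lt_trans x1 k2).
have fink k : (block_norm p w (fun x => (\1_A x)%:E) k < +oo)%E.
  have mJ : measurable (unit_interval k : set R) by exact: measurable_itv.
  have mA : measurable A by exact: measurable_itv.
  rewrite /block_norm.
  rewrite (_ : (fun x : R => _) = (fun x : R => (\1_(A `&` unit_interval k) x)%:E)); last first.
    by apply/funext => x; rewrite -EFinM !indicE in_setI -natrM mulnb.
  apply: wnorm_indic_lty; first exact: measurableI.
  have [[_ _ wK] _] := ww.
  apply: le_lt_trans (wK _ (subsetT _) (@segment_compact R k%:~R (k + 1)%:~R)).
  under [leRHS]eq_integral => x _ do rewrite ger0_norm ?(ltW (w_gt0 x))//.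
  apply: ge0_subset_integral => //.
  - exact: measurableI.
  - by apply: measurable_funTS; exact/measurable_EFinP.
  - by move=> x _; rewrite lee_fin ltW.
  - by move=> x [_]; rewrite /unit_interval /= !in_itv/= => /andP[-> /ltW ->].
rewrite (esumID D) ?setTI; last by move=> k _; exact: poweR_ge0.
rewrite [X in (_ + X)%E]esum1; last first.
  by move=> k /= Dk; rewrite zero// poweR0r// gt_eqF// (lt_le_trans ltr01).
rewrite adde0 esum_fset//; last by move=> k _; exact: poweR_ge0.
rewrite fsbig_finite//; elim: (finmap.enum_fset _) => [|k s IH].
  by rewrite big_nil.
rewrite big_cons; apply: lte_add_pinfty => //; exact: poweR_lty.
Qed.
End amalgam_space.

(** * Bounded kernels and regularity of the mollifier *)

Section kernel.
Context {R : realType}.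
Notation mu := (@lebesgue_measure R).
Implicit Types (f g k phi : R -> R) (E : set R) (c e x y : R).

(** Shared by all convolution estimates, with k a dilated mollifier or a difference of two.
    Integrability is part of the conclusion because the real-valued integral is linear only on
    integrable functions. *)
Lemma kernel_bound k g E c : measurable_fun [set: R] k ->
  measurable_fun [set: R] g -> measurable E -> 0 <= c ->
  (forall y, E y -> `|k y| <= c) -> (forall y, ~ E y -> k y = 0) ->
  (\int[mu]_(y in E) `|g y|%:E < +oo)%E ->
  mu.-integrable [set: R] (EFin \o (fun y => k y * g y)) /\
  ((`|\int[mu]_y (k y * g y)|)%:E <= c%:E * \int[mu]_(y in E) `|g y|%:E)%E.
Proof.
move=> mk mg mE c0 kc k0 goo.
have mag : measurable_fun E (fun y => `|g y|%:E).
  by apply: measurable_funTS; apply/measurable_EFinP; exact: measurableT_comp.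
have mkg : measurable_fun [set: R] (fun y => k y * g y) by exact: measurable_funM.
have mF : measurable_fun [set: R] ((fun y => (c * `|g y|)%:E) \_ E).
  apply: (measurable_restrictT _ mE).1; apply: measurable_funTS.
  by apply/measurable_EFinP; apply: measurable_funM => //; exact: measurableT_comp.
have le : (\int[mu]_y `|(k y * g y)%:E| <= c%:E * \int[mu]_(y in E) `|g y|%:E)%E.
  rewrite -ge0_integralZl// [leRHS]integral_mkcond.
  apply: ge0_le_integral => //.
  - by apply: measurableT_comp => //; exact/measurable_EFinP.
  - move=> y _; rewrite patchE; case: ifPn => [/set_mem yE|/negP yE].
      by rewrite -EFinM lee_fin normrM ler_wpM2r// kc.
    by rewrite k0 ?mul0r ?abse0// => yE'; apply: yE; rewrite inE.
have ikg : mu.-integrable [set: R] (EFin \o (fun y => k y * g y)).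
  apply/integrableP; split; first exact/measurable_EFinP.
  by apply: le_lt_trans le _; apply: lte_mul_pinfty => //; rewrite lee_fin.
split=> //; apply: le_trans le.
have fin : (\int[mu]_y (k y * g y)%:E)%E \is a fin_num by exact: integrable_fin_num.
rewrite /Rintegral -[X in (X <= _)%E]/(`|(fine _)%:E|%E) fineK//.
by apply: le_abse_integral => //; exact/measurable_EFinP.
Qed.

Variable phi : R -> R.
Hypothesis phi_mollifier : mollifier phi.

Lemma mollifier_continuous : continuous phi.
Proof.
case: phi_mollifier => d _ _ _ _ x.
by apply: differentiable_continuous; apply/derivable1_diffP; exact: (d 0%N).
Qed.

Lemma mollifier_measurable : measurable_fun [set: R] phi.
Proof. by apply: continuous_measurable_fun; exact: mollifier_continuous. Qed.

Lemma mollifier_lipschitz : exists2 L : R, 0 <= L &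
  forall x y, `|phi x - phi y| <= L * `|x - y|.
Proof.
case: phi_mollifier => d _ [radial _] zero _.
have d0 x : derivable phi x 1 by exact: (d 0%N).
have cd : continuous (fun x => `|(derive1 phi) x|).
  move=> x; apply: cvg_norm; apply: differentiable_continuous.
  by apply/derivable1_diffP; exact: (d 1%N).
have [c _ hc] := @EVT_max R (fun x => `|(derive1 phi) x|) (-1) 1 ltac:(lra)
   (continuous_subspaceT cd).
exists `|(derive1 phi) c| => //.
(* Clamping to [-1, 1] leaves phi unchanged, as phi is 0 at the endpoints and beyond, and it does
   not increase distances. The mean value theorem is then needed only where the maximum of |phi'|
   was taken. *)
pose cl x := Num.max (-1) (Num.min x 1).
have phicl x : phi x = phi (cl x).
  rewrite /cl minEle; case: ifPn => [x1|]; rewrite ?maxEle.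
    case: ifPn => // ; rewrite -ltNge => x2.
    by rewrite !zero// ?normrN ?normr1// ler_normr; apply/orP; right; lra.
  rewrite -ltNge => x1; case: ifPn => [_|]; last by rewrite -ltNge; lra.
  by rewrite !zero ?normr1// ler_normr; apply/orP; left; lra.
have cl1 x : (-1 <= cl x) * (cl x <= 1).
  by rewrite /cl le_max lexx ge_max ge_min lexx orbT; split=> //=; lra.
have main x y : x <= y -> `|phi x - phi y| <= `|(derive1 phi) c| * (y - x).
  move=> xy; rewrite (phicl x) (phicl y).
  have clxy : cl x <= cl y.
    by rewrite /cl !minEle !maxEle; do 4 case: ifPn; rewrite -?ltNge; lra.
  have cllip : cl y - cl x <= y - x.
    by rewrite /cl !minEle !maxEle; do 4 case: ifPn; rewrite -?ltNge; lra.
  have [z zin E] := @MVT_segment R phi (derive1 phi) (cl x) (cl y) clxy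
    (fun z _ => ltac:(by apply: DeriveDef => //; rewrite derive1E))
    (continuous_subspaceT mollifier_continuous).
  rewrite distrC E normrM [X in _ * X]ger0_norm ?subr_ge0//.
  apply: ler_pM; rewrite ?subr_ge0//.
  apply: hc; move: zin; rewrite !in_itv/= => /andP[z1 z2].
  by rewrite (le_trans _ z1) ?(le_trans z2) ?cl1.
move=> x y; have [xy|/ltW xy] := leP x y.
  by rewrite [in leRHS]distrC [X in _ * X]ger0_norm ?subr_ge0// main.
by rewrite distrC [X in _ * X]ger0_norm ?subr_ge0// main.
Qed.

Lemma integral_dilation e x : 0 < e -> (\int[mu]_y (dilation phi e (x - y))%:E = 1)%E.
Proof.
move=> e0; case: (phi_mollifier) => _ phi0 [radial _] _ <-.
(* The substitution must be increasing, hence y - x instead of x - y; radiality of phi absorbs the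
   sign. *)
pose F y := (y - x) * e^-1.
have dF y : is_derive y 1 F e^-1.
  rewrite /F; apply: is_derive_eq.
  by rewrite scaler0 ?add0r ?addr0 ?subr0 /GRing.scale/= ?mulr1 ?mul1r.
have F'E : derive1 F = cst e^-1 by apply/funext => y; rewrite derive1E; exact: derive_val.
rewrite (@increasing_ge0_integration_by_substitutionT R F phi)//.
- apply: eq_integral => y _; rewrite F'E /= /dilation/= /F mulrC; congr (_ * _)%:E.
  by apply: radial; rewrite !normrM distrC.
- by move=> y z yz; rewrite /F ltr_pM2r ?invr_gt0// ltrD2r.
- by rewrite F'E => y; exact: cvg_cst.
- by rewrite F'E; exact: is_cvg_cst.
- by rewrite F'E; exact: is_cvg_cst.
- by apply: gt0_cvgMlNy; [rewrite invr_gt0|exact: cvg_addrr_Ny].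
- by apply: gt0_cvgMly; [rewrite invr_gt0|exact: cvg_addrr].
- exact: mollifier_continuous.
Qed.
End kernel.

(** * Pointwise estimates for mollified functions *)

Section convolution.
Context {R : realType}.
Notation mu := (@lebesgue_measure R).
Variable phi : R -> R.
Hypothesis phi_mollifier : mollifier phi.
Implicit Types (f : R -> R) (e x y : R).
Notation conv e f := (convolution (dilation phi e) f).

Let phi_ge0 x : 0 <= phi x. Proof. by case: phi_mollifier. Qed.

Let phi_le0 x : phi x <= phi 0.
Proof. by case: phi_mollifier => _ _ [_ +] _ _; apply; rewrite normr0. Qed.

Lemma dilation_ge0 e x : 0 < e -> 0 <= dilation phi e x.
Proof. by move=> e0; rewrite mulr_ge0// invr_ge0 ltW. Qed.

Lemma dilation_le e x : 0 < e -> `|dilation phi e x| <= phi 0 / e.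
Proof.
move=> e0; rewrite ger0_norm ?dilation_ge0// /dilation mulrC ler_wpM2r//.
by rewrite invr_ge0 ltW.
Qed.

Lemma dilation_eq0 e x y : 0 < e -> ~ ball x e y -> dilation phi e (x - y) = 0.
Proof.
case: (phi_mollifier) => _ _ _ zero _ e0 xy; rewrite /dilation zero ?mulr0//.
rewrite normrM normfV (gtr0_norm e0) ler_pdivlMr// mul1r leNgt.
by apply/negP => h; exact: xy.
Qed.

Lemma measurable_dilation e x : measurable_fun [set: R] (fun y => dilation phi e (x - y)).
Proof.
have mphi := mollifier_measurable phi_mollifier.
apply: measurable_funM => //; apply: (measurableT_comp mphi).
by apply: measurable_funM => //; exact: measurable_funB.
Qed.

Lemma locally_integrable_itv f (a b : R) : locally_integrable [set: R] f ->
  (\int[mu]_(y in `[a, b]) `|f y|%:E < +oo)%E.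
Proof. by case=> _ _; apply => //; exact: segment_compact. Qed.

Lemma locally_integrable_subset f (a b : R) (E : set R) : measurable E -> E `<=` `[a, b] ->
  locally_integrable [set: R] f -> (\int[mu]_(y in E) `|f y|%:E < +oo)%E.
Proof.
move=> mE Eab lf; apply: le_lt_trans (locally_integrable_itv a b lf).
apply: ge0_subset_integral => //.
apply: measurable_funTS; apply/measurable_EFinP; apply: measurableT_comp => //.
by case: lf.
Qed.

Lemma locally_integrable_ball f x e : locally_integrable [set: R] f ->
  (\int[mu]_(y in ball x e) `|f y|%:E < +oo)%E.
Proof.
apply: (@locally_integrable_subset _ (x - e) (x + e)); first exact: measurable_ball.
by move=> y; rewrite /ball/= ltr_distlC in_itv/= => /andP[/ltW -> /ltW ->].
Qed.

Lemma dilation_mul_integrable e f x : 0 < e -> locally_integrable [set: R] f ->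
  mu.-integrable [set: R] (EFin \o (fun y => dilation phi e (x - y) * f y)).
Proof.
move=> e0 lf; have [mf _ _] := lf.
apply: (@kernel_bound _ (fun y => dilation phi e (x - y)) f (ball x e) (phi 0 / e)
  (measurable_dilation e x) mf (measurable_ball x e)
  (divr_ge0 (phi_ge0 0) (ltW e0)) (fun y _ => dilation_le _ e0)
  (fun y => @dilation_eq0 _ _ _ e0) (locally_integrable_ball x e lf)).1.
Qed.

Lemma convolutionB e f g x : 0 < e -> locally_integrable [set: R] f ->
  locally_integrable [set: R] g -> conv e (f \- g) x = conv e f x - conv e g x.
Proof.
move=> e0 lf lg; rewrite /convolution -RintegralB//; try exact: dilation_mul_integrable.
by apply: eq_Rintegral => y _; rewrite -mulrBr.
Qed.

(** Origin of the factor 2: [ball x e] has measure 2e, while the kernel is bounded by phi 0 / e. *)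
Let twice_iavg f x e : 0 < e -> ((phi 0 / e)%:E * \int[mu]_(y in ball x e) `|f y|%:E
  = (2 * phi 0)%:E * iavg f (ball x e))%E.
Proof.
move=> e0; rewrite /iavg lebesgue_measure_ball ?ltW// inver.
rewrite gt_eqF ?mulrn_wgt0// muleA -EFinM; congr (_%:E * _)%E.
by rewrite -(mulr_natl e) invfM; field; rewrite gt_eqF.
Qed.

Lemma convolution_le_HL_maximal e f x : 0 < e -> locally_integrable [set: R] f ->
  (`|conv e f x|%:E <= (2 * phi 0)%:E * HL_maximal f x)%E.
Proof.
move=> e0 lf; have [mf _ _] := lf.
have [_] := @kernel_bound _ (fun y => dilation phi e (x - y)) f (ball x e) (phi 0 / e)
  (measurable_dilation e x) mf (measurable_ball x e)
  (divr_ge0 (phi_ge0 0) (ltW e0)) (fun y _ => dilation_le _ e0)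
  (fun y => @dilation_eq0 _ _ _ e0) (locally_integrable_ball x e lf).
move=> /le_trans; apply; rewrite twice_iavg//.
rewrite lee_wpmul2l ?lee_fin ?mulr_ge0//.
by apply: ereal_sup_ubound; exists e => //=; rewrite in_itv/= e0.
Qed.

Let ball_sub_itv e a x y : `|x| <= a -> ball x e y ->
  `[(- (a + e)), (a + e)]%classic y.
Proof.
by rewrite /ball/= ltr_distlC in_itv/= ler_norml => /andP[? ?] /andP[? ?]; lra.
Qed.

Lemma convolution_bound (e a : R) f x : 0 < e -> locally_integrable [set: R] f ->
  `|x| <= a ->
  (`|conv e f x|%:E
    <= (phi 0 / e)%:E * \int[mu]_(y in `[(- (a + e))%R, (a + e)%R]) `|f y|%:E)%E.
Proof.
move=> e0 lf xa; have [mf _ _] := lf.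
apply: (@kernel_bound _ (fun y => dilation phi e (x - y)) f _ (phi 0 / e)
  (measurable_dilation e x) mf (measurable_itv _)
  (divr_ge0 (phi_ge0 0) (ltW e0)) (fun y _ => dilation_le _ e0) _
  (locally_integrable_itv _ _ lf)).2.
by move=> y ny; apply: dilation_eq0 => // /(ball_sub_itv xa).
Qed.

Lemma convolution_lipschitz : exists2 L : R, 0 <= L & forall (e a : R) f x x',
  0 < e -> locally_integrable [set: R] f -> `|x| <= a -> `|x'| <= a ->
  (`|conv e f x - conv e f x'|%:E <= (L / e / e * `|x - x'|)%:E *
    \int[mu]_(y in `[(- (a + e))%R, (a + e)%R]) `|f y|%:E)%E.
Proof.
have [L L0 hL] := mollifier_lipschitz phi_mollifier.
exists L => // e a f x x' e0 lf xa x'a; have [mf _ _] := lf.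
have zero z y : `|z| <= a -> ~ `[(- (a + e)), (a + e)]%classic y -> dilation phi e (z - y) = 0.
  by move=> za ny; apply: dilation_eq0 => // /(ball_sub_itv za).
rewrite /convolution -RintegralB//; try exact: dilation_mul_integrable.
under eq_Rintegral do rewrite -mulrBl.
apply: (@kernel_bound _ (fun y => dilation phi e (x - y) - dilation phi e (x' - y)) f _ _
  _ mf (measurable_itv _) _ _ _ (locally_integrable_itv _ _ lf)).2.
- by apply: measurable_funB; exact: measurable_dilation.
- by rewrite !mulr_ge0// invr_ge0 ltW.
- move=> y _; rewrite /dilation -mulrBr normrM normfV (gtr0_norm e0).
  rewrite mulrC -mulrA mulrAC ler_wpM2r ?invr_ge0 ?(ltW e0)//.
  rewrite (le_trans (hL _ _))// -mulrBl normrM normfV (gtr0_norm e0).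
  have -> : x - y - (x' - y) = x - x' by ring.
  by rewrite [in leRHS](mulrC e^-1).
- by move=> y yE; rewrite !zero ?subr0.
Qed.

Lemma convolution_continuous e f : 0 < e -> locally_integrable [set: R] f ->
  continuous (conv e f).
Proof.
move=> e0 lf x; have [L L0 hL] := convolution_lipschitz.
(* The margin 1 keeps the points y with |x - y| <= 1 inside [-a, a], where one Lipschitz constant
   holds. *)
pose a := `|x| + 1; set I := (\int[mu]_(y in `[(- (a + e))%R, (a + e)%R]) `|f y|%:E)%E.
have Ifin : I \is a fin_num.
  by rewrite ge0_fin_numE; [exact: locally_integrable_itv|exact: integral_ge0].
pose K := L / e / e * fine I.
have K0 : 0 <= K by rewrite !mulr_ge0 ?invr_ge0 ?(ltW e0)// fine_ge0// integral_ge0.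
apply/cvgrPdist_le => /= eps eps0.
near=> y.
have xy : `|x - y| <= 1 by near: y; apply: cvgr_dist_le.
have xy2 : `|x - y| <= eps / (K + 1).
  by near: y; apply: cvgr_dist_le => //; rewrite divr_gt0// ltr_wpDl.
have := hL e a f x y e0 lf _ _; rewrite -/I -(fineK Ifin) -EFinM lee_fin.
have xa : `|x| <= a by rewrite lerDl.
have ya : `|y| <= a.
  rewrite /a; have := ler_normD x (y - x); rewrite addrC subrK distrC; lra.
move=> /(_ xa ya) /le_trans; apply.
have -> : L / e / e * `|x - y| * fine I = K * `|x - y| by rewrite /K; ring.
apply: (@le_trans _ _ (K * (eps / (K + 1)))); first by rewrite ler_wpM2l.
by rewrite mulrCA ger_pMr// ler_pdivrMr ?mul1r ?lerDl// ltr_wpDl.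
Unshelve. all: by end_near. Qed.

Lemma convolution_measurable e f : 0 < e -> locally_integrable [set: R] f ->
  measurable_fun [set: R] (conv e f).
Proof.
by move=> e0 lf; apply: continuous_measurable_fun; exact: convolution_continuous.
Qed.

(** The dilated kernel has integral 1, so f x can be moved under the integral; the kernel bound
    applied to f - f x then yields the averaged deviation of Lebesgue differentiation. *)
Lemma convolution_sub_le_davg e f x : 0 < e -> locally_integrable [set: R] f ->
  (`|conv e f x - f x|%:E <= (2 * phi 0)%:E * davg f x e)%E.
Proof.
move=> e0 lf; have [mf _ _] := lf.
pose g := center (f x) \o f.
have mg : measurable_fun [set: R] g by exact: measurable_funB.
have mc : measurable_fun [set: R] (cst (f x) : R -> R) by exact: measurable_cst.
have coo : (\int[mu]_(y in ball x e) `|cst (f x) y|%:E < +oo)%E.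
  rewrite (@integral_cst _ _ _ mu _ _ `|f x|%:E); last exact: measurable_ball.
  have muB : (mu (ball x e) = (e *+ 2)%:E)%E by rewrite lebesgue_measure_ball ?ltW.
  by rewrite [X in (_ * X)%E]muB -EFinM ltry.
have goo : (\int[mu]_(y in ball x e) `|g y|%:E < +oo)%E.
  have mf' : measurable_fun (ball x e) f by exact: measurable_funTS.
  apply: (@le_lt_trans _ _ (\int[mu]_(y in ball x e) (`|f y|%:E + `|f x|%:E))%E).
    apply: ge0_le_integral => //.
    - exact: measurable_ball.
    - by apply: measurable_funTS; apply/measurable_EFinP; exact: measurableT_comp.
    - apply: measurable_funTS; apply: emeasurable_funD => //.
      by apply/measurable_EFinP; exact: measurableT_comp.
    - by move=> y _; rewrite -EFinD lee_fin ler_normB.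
  rewrite ge0_integralD//; first last.
  - apply: measurable_funTS; apply/measurable_EFinP; exact: measurableT_comp.
  - exact: measurable_ball.
  by apply: lte_add_pinfty; first exact: locally_integrable_ball.
have kb h mh := @kernel_bound _ (fun y => dilation phi e (x - y)) h (ball x e) (phi 0 / e)
  (measurable_dilation e x) mh (measurable_ball x e)
  (divr_ge0 (phi_ge0 0) (ltW e0)) (fun y _ => dilation_le _ e0)
  (fun y => @dilation_eq0 _ _ _ e0).
have [cint _] := kb _ mc coo.
have [_] := kb _ mg goo.
rewrite twice_iavg//; suff -> : \int[mu]_y (dilation phi e (x - y) * g y) = conv e f x - f x by [].
rewrite /convolution.
have {1}-> : f x = \int[mu]_y (dilation phi e (x - y) * cst (f x) y).
  have i1 : mu.-integrable [set: R] (EFin \o (fun y => dilation phi e (x - y))).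
    apply/integrableP; split; first by apply/measurable_EFinP; exact: measurable_dilation.
    under eq_integral => y _ do rewrite gee0_abs ?lee_fin ?dilation_ge0//.
    by rewrite integral_dilation// ltry.
  under eq_Rintegral do rewrite mulrC.
  by rewrite RintegralZl// /Rintegral integral_dilation// mulr1.
rewrite -RintegralB//; last exact: dilation_mul_integrable.
apply: eq_Rintegral => y _.
by rewrite -mulrBr.
Qed.
End convolution.

(** * Finite nets by coding *)

Section finite_nets.
Context {R : realType}.

(** Monotonicity in M lets a maximum serve all elements of G. Q is a norm bound in one use and a
    tail estimate beyond radius M in the other. *)
Lemma finite_uniform {T : eqType} (G : set T) (Q : T -> R -> Prop) : finite_set G ->
  (forall g, G g -> exists M, Q g M) ->
  (forall g M M', M <= M' -> Q g M -> Q g M') ->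
  exists M, forall g, G g -> Q g M.
Proof.
move=> /finite_seqP[s ->] GQ Qmono; elim: s GQ => [|t s IH] GQ.
  by exists 0 => g; rewrite /= in_nil.
have [M1 h1] := GQ t (mem_head _ _).
have [M2 h2] : exists M, forall g, [set` s] g -> Q g M.
  by apply: IH => g gs; apply: GQ; rewrite /= in_cons gs orbT.
exists (Num.max M1 M2) => g /=; rewrite in_cons => /predU1P[->|gs].
  by apply: Qmono h1; rewrite le_max lexx.
by apply: Qmono (h2 _ gs); rewrite le_max lexx orbT.
Qed.

(** One representative in S is chosen for each attained code; codes that are not attained receive
    the default f0. *)
Lemma finite_code {T : choiceType} {C : finType} (S : set T) (code : T -> C) :
  exists G : set T, [/\ finite_set G, G `<=` S &
    forall f, S f -> exists2 g, G g & code f = code g].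
Proof.
have [[f0 Sf0]|S0] := pselect (S !=set0); last first.
  exists set0; split=> // f Sf; exfalso; apply: S0; by exists f.
have rep c : exists g, S g /\ ((exists2 f, S f & code f = c) -> code g = c).
  have [[f Sf fc]|nc] := pselect (exists2 f, S f & code f = c); first by exists f.
  by exists f0; split.
have [r hr] := choice rep.
exists (r @` [set: C]); split.
- exact/finite_image/finite_finset.
- by move=> _ [c _ <-]; case: (hr c).
- move=> f Sf; exists (r (code f)); first by exists (code f).
  by rewrite (hr (code f)).2//; exists f.
Qed.

(* The totally bounded half of Arzela-Ascoli, for uniformly Lipschitz families:
   f is coded by the rounded values of Phi f on a fine grid. *)
Lemma uniform_net {T : choiceType} (S : set T) (Phi : T -> R -> R) (a A B d : R) :
  0 < d -> 0 <= B ->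
  (forall f x, S f -> `|x| <= a -> `|Phi f x| <= A) ->
  (forall f x y, S f -> `|x| <= a -> `|y| <= a ->
    `|Phi f x - Phi f y| <= B * `|x - y|) ->
  exists G : set T, [/\ finite_set G, G `<=` S &
    forall f, S f -> exists2 g, G g &
      forall x, `|x| <= a -> `|Phi f x - Phi g x| <= 3 * d].
Proof.
move=> d0 B0 Phi_bd Phi_lip.
(* With this mesh each Phi f varies by at most d within a cell; B + 1 avoids division by zero. *)
pose h := d / (B + 1); have h0 : 0 < h by rewrite divr_gt0// ltr_wpDl.
have Bh : B * h <= d.
  by rewrite /h mulrCA ger_pMr// ler_pdivrMr ?mul1r ?lerDl// ltr_wpDl.
(* N bounds the index of a grid point in [-a, a] and M the level of a value in [-A, A], so [inord]
   loses nothing where the code is read back. *)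
pose N := Num.truncn (2 * a / h); pose M := Num.truncn (2 * A / d).
pose pt (i : nat) := - a + i%:R * h.
pose lvl f i := Num.truncn ((Phi f (pt i) + A) / d).
pose code f := [ffun i : 'I_N.+1 => inord (lvl f i) : 'I_M.+1].
have [G [finG GS hG]] := finite_code S code.
exists G; split=> // f Sf; have [g Gg fg] := hG f Sf.
have Sg := GS _ Gg.
exists g => // x xa.
have [x1 x2] : - a <= x /\ x <= a by move: xa; rewrite ler_norml => /andP.
pose i := Num.truncn ((x + a) / h).
have xh0 : 0 <= (x + a) / h by rewrite divr_ge0 ?(ltW h0)//; lra.
have iN : (i < N.+1)%N.
  rewrite ltnS; apply: le_truncn.
  rewrite ler_pM2r ?invr_gt0//; lra.
have [ix1 ix2] : pt i <= x /\ x < pt i + h.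
  have := truncn_itv xh0; rewrite -/i ler_pdivlMr// ltr_pdivrMr// => /andP[].
  by rewrite /pt -natr1 mulrDl mul1r => ? ?; split; lra.
have pa : `|pt i| <= a.
  have : 0 <= i%:R * h by rewrite mulr_ge0// ltW.
  by rewrite ler_norml /pt => ?; apply/andP; split; move: ix1; rewrite /pt; lra.
have xp : `|x - pt i| <= h by rewrite ler_norml; apply/andP; split; lra.
have lvlM k : S k -> (lvl k i < M.+1)%N.
  move=> Sk; have := Phi_bd _ _ Sk pa; rewrite ler_norml => /andP[k1 k2].
  rewrite ltnS; apply: le_truncn.
  rewrite ler_pM2r ?invr_gt0//; lra.
have lvlE : lvl f i = lvl g i.
  have := congr1 (fun c : {ffun 'I_N.+1 -> 'I_M.+1} => nat_of_ord (c (Ordinal iN))) fg.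
  by rewrite /code !ffunE !inordK//= lvlM.
have lvl_itv k : S k -> (lvl k i)%:R * d <= Phi k (pt i) + A /\
    Phi k (pt i) + A < (lvl k i)%:R * d + d.
  move=> Sk; have := Phi_bd _ _ Sk pa; rewrite ler_norml => /andP[k1 k2].
  have : 0 <= (Phi k (pt i) + A) / d by rewrite divr_ge0 ?(ltW d0)//; lra.
  move=> /truncn_itv; rewrite -/(lvl k i) ler_pdivlMr// ltr_pdivrMr// -natr1.
  by rewrite mulrDl mul1r => /andP.
have [f1 f2] := lvl_itv _ Sf; have [g1 g2] := lvl_itv _ Sg; rewrite lvlE in f1 f2.
(* Equal levels put the values at the grid point within d; passing between x and the grid point
   costs another d for each of f and g. *)
have mid : `|Phi f (pt i) - Phi g (pt i)| <= d.
  by rewrite ler_norml; apply/andP; split; lra.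
have lip k : S k -> `|Phi k x - Phi k (pt i)| <= d.
  move=> Sk; rewrite (le_trans (Phi_lip _ _ _ Sk xa pa))//.
  by rewrite (le_trans _ Bh)// ler_wpM2l.
have := lip _ Sf; have := lip _ Sg; move: mid; rewrite !ler_norml.
by move=> /andP[? ?] /andP[? ?] /andP[? ?]; apply/andP; split; lra.
Qed.
End finite_nets.

Lemma mul_maxe_lt {R : realType} (c : R) (a b m : \bar R) : 0 < c ->
  (a < m)%E -> (b < m)%E -> (c%:E * maxe a b < c%:E * m)%E.
Proof. by move=> c0 am bm; rewrite lte_pmul2l ?gt_max ?am ?bm ?lte_fin. Qed.

Lemma mul_maxe_lty {R : realType} (c : R) (a b : \bar R) : 0 < c ->
  (a < +oo)%E -> (b < +oo)%E -> (c%:E * maxe a b < +oo)%E.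
Proof. by move=> c0 aoo boo; rewrite -(gt0_muley (x := c%:E))//; exact: mul_maxe_lt. Qed.

(** Dominated convergence is available for sequences, while the mollification parameter is real. If
    A failed arbitrarily close to 0, failures below 1/(n+1) would form a sequence tending to 0. *)
Lemma near_right0_seq {R : realType} (A : R -> Prop) :
  (forall u : nat -> R, (forall n, 0 < u n) ->
     (forall r, 0 < r -> \forall n \near \oo, u n < r) ->
     \forall n \near \oo, A (u n)) ->
  \forall e \near 0^'+, A e.
Proof.
move=> hA; apply: contrapT => nA.
have bad n : exists e : R, [/\ 0 < e, e < n.+1%:R^-1 & ~ A e].
  apply: contrapT => no; apply: nA.
  have small : \forall e \near 0^'+, e < n.+1%:R^-1 :> R by exact: nbhs_right_lt.
  have pos : \forall e \near 0^'+, 0 < e :> R by exact: nbhs_right_gt.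
  apply: filterS2 small pos => e e1 e0.
  by apply: contrapT => nAe; apply: no; exists e.
have [u hu] := choice bad.
have [] := hA u.
- by move=> n; case: (hu n).
- move=> r r0; have : \forall n \near \oo, n.+1%:R^-1 < r.
    exact: near_infty_natSinv_lt (PosNum r0).
  by apply: filterS => n nr; case: (hu n) => _ /lt_trans + _; apply.
- by move=> n _ /(_ n (leqnn n)); case: (hu n).
Qed.

(** * Truncation and mollification of a single function *)

Section amalgam_approximation.
Context {R : realType}.
Notation mu := (@lebesgue_measure R).
Variables (p w : R -> R) (q P : R).
Hypothesis mp : measurable_fun [set: R] p.
Hypothesis p_ge1 : forall x, 1 <= p x.
Hypothesis p_gt1 : {ae mu, forall x, 1 < p x}.
Hypothesis p_le : forall x, p x <= P.
Hypothesis ww : weight w.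
Hypothesis q_ge1 : 1 <= q.
Hypothesis w_muckenhoupt : muckenhoupt p w.

Let mw : measurable_fun [set: R] w. Proof. by case: ww => -[]. Qed.
Let w_gt0 x : 0 < w x. Proof. by case: ww => _ /(_ x). Qed.
Notation N := (amalgam_norm p w q).

Lemma amalgam_norm_quasi_lt (f g h : R -> \bar R) (m : R) : measurable_fun [set: R] f ->
  measurable_fun [set: R] g -> measurable_fun [set: R] h ->
  (forall x, (`|h x| <= `|f x| + `|g x|)%E) ->
  (N f < m%:E)%E -> (N g < m%:E)%E -> (N h < (8 * m)%:E)%E.
Proof.
move=> mf mg mh hfg fm gm.
apply: le_lt_trans (amalgam_norm_quasi_triangle mp p_ge1 mw w_gt0 q_ge1 mf mg mh hfg) _.
by rewrite EFinM; apply: (mul_maxe_lt _ fm gm).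
Qed.

Lemma amalgam_sub (f g : R -> R) : amalgam p w q f -> amalgam p w q g ->
  amalgam p w q (f \- g).
Proof.
move=> fa ga; have mf := amalgam_measurable fa; have mg := amalgam_measurable ga.
have mfg : measurable_fun [set: R] (f \- g) by exact: measurable_funB.
case: fa => floc fN; case: ga => gloc gN; split; last first.
  apply: le_lt_trans (amalgam_norm_quasi_triangle mp p_ge1 mw w_gt0 q_ge1
    (f := EFin \o f) (g := EFin \o g) _ _ _ _) _; try exact/measurable_EFinP.
    by move=> x; rewrite -EFinD lee_fin ler_normB.
  exact: (mul_maxe_lty _ fN gN).
move=> K cK; have [mfK fK] := floc K cK; have [mgK gK] := gloc K cK.
have mK : measurable K by apply: closed_measurable; apply: compact_closed => //; exact: Rhausdorff.
have mfgK : measurable_fun [set: R] ((f \- g) \* \1_K).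
  by apply: measurable_funM => //; exact: measurable_indic.
split; first exact: mfgK.
apply: le_lt_trans (wnorm_quasi_triangle mp p_ge1 mw w_gt0
    (f := EFin \o (f \* \1_K)) (g := EFin \o (g \* \1_K)) _ _ _ _) _;
    try exact/measurable_EFinP.
  by move=> x; rewrite -EFinD lee_fin/= mulrBl ler_normB.
exact: (mul_maxe_lty _ fK gK).
Qed.

(** Cut-offs at natural radii are dominated by f and eventually vanish at each point; monotonicity
    of the norm passes to all larger real radii, so that finitely many functions can share one
    radius. *)
Lemma amalgam_norm_tail (f : R -> R) (e : R) : amalgam p w q f -> 0 < e ->
  exists n0 : nat, forall gamma : R, n0%:R <= gamma ->
    (N (EFin \o (f \* \1_[set x | (gamma < `|x|)%R])%R) < e%:E)%E.
Proof.
move=> fa e0; have mf := amalgam_measurable fa; case: fa => _ fN.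
have mA (gamma : R) : measurable [set x : R | gamma < `|x|].
  rewrite -[X in measurable X]setTI.
  exact: (measurable_fun_ltr (f := cst gamma) (g := fun x : R => `|x|)).
have mfA gamma : measurable_fun [set: R] (EFin \o (f \* \1_[set x | gamma < `|x|])%R).
  by apply/measurable_EFinP; apply: measurable_funM => //; exact: measurable_indic.
pose g n := EFin \o (f \* \1_[set x | n%:R < `|x|])%R.
have gf n x : (`|g n x| <= `|(EFin \o f) x|)%E.
  rewrite lee_fin/= normrM ler_piMr// indicE.
  by case: (_ \in _); rewrite ?normr1 ?normr0.
have g0 : {ae mu, forall x, g ^~ x @ \oo --> 0%E}.
  apply: aeW => x; apply: cvg_near_cst; near=> n.
  rewrite /g /= indicE memNset ?mulr0//=.
  by apply/negP; rewrite -leNgt; near: n; exact: nbhs_infty_ger.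
have mEf : measurable_fun [set: R] (EFin \o f) by exact/measurable_EFinP.
have [n0 _ hn0] := amalgam_norm_dominated mp p_ge1 p_le mw w_gt0 q_ge1
  (fun n => mfA n%:R) mEf gf g0 fN e0.
exists n0 => gamma n0g; apply: le_lt_trans (hn0 n0 (leqnn _)).
apply: amalgam_norm_mono => // x; rewrite lee_fin /= !normrM ler_wpM2l// !indicE.
have [/set_mem/= xg|_] := boolP (_ \in [set x | gamma < `|x|]); last by rewrite normr0.
by rewrite mem_set//=; exact: le_lt_trans xg.
Unshelve. all: by end_near. Qed.

Variable phi : R -> R.
Hypothesis phi_mollifier : mollifier phi.
Hypothesis maximal_bounded : HL_maximal_bounded p w q.

Notation conv e f := (convolution (dilation phi e) f).
(** The summand 1 gives the positivity that the scaling lemmas ask for, without a proof that phi 0 >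
    0. *)
Let c := 2 * phi 0 + 1.
Let phi00 : 0 <= phi 0. Proof. by case: phi_mollifier. Qed.
Let c_gt0 : 0 < c. Proof. by rewrite ltr_wpDl// mulr_ge0. Qed.

Let conv_le e f x : 0 < e -> locally_integrable [set: R] f ->
  (`|conv e f x|%:E <= c%:E * `|HL_maximal f x|)%E.
Proof.
move=> e0 lf; apply: le_trans (convolution_le_HL_maximal phi_mollifier x e0 lf) _.
rewrite gee0_abs ?HL_maximalT_ge0// lee_wpmul2r ?HL_maximalT_ge0//.
by rewrite lee_fin lerDl.
Qed.

Lemma amalgam_mollifier_cvg (f : R -> R) (eta : R) : amalgam p w q f -> 0 < eta ->
  \forall e \near 0^'+, (N (EFin \o (conv e f \- f)%R) < eta%:E)%E.
Proof.
move=> fa eta0; have mf := amalgam_measurable fa.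
have lf := amalgam_locally_integrable mp p_ge1 p_gt1 ww q_ge1 w_muckenhoupt fa.
have mHL := measurable_HL_maximal lf.
apply: near_right0_seq => u u0 ucvg.
pose h x := (c%:E * HL_maximal f x + `|f x|%:E)%E.
have HL0 x : (0 <= HL_maximal f x)%E by exact: HL_maximalT_ge0.
have mcHL : measurable_fun [set: R] (fun x => c%:E * HL_maximal f x)%E.
  exact: measurable_funeM.
have mh : measurable_fun [set: R] h.
  apply: emeasurable_funD => //.
  by apply/measurable_EFinP; exact: measurableT_comp.
have habs x : `|h x|%E = h x.
  by rewrite gee0_abs// adde_ge0// mule_ge0// lee_fin ltW.
apply: (@amalgam_norm_dominated _ p w q P mp p_ge1 p_le mw w_gt0 q_ge1
  (fun n => EFin \o (conv (u n) f \- f)%R) h) => //.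
- move=> n; apply/measurable_EFinP; apply: measurable_funB => //.
  exact: convolution_measurable.
- move=> n x; rewrite habs /=.
  apply: (@le_trans _ _ (`|conv (u n) f x|%:E + `|f x|%:E)%E).
    by rewrite -EFinD lee_fin ler_normB.
  rewrite leeD2r//; apply: le_trans (conv_le _ _ _) _ => //.
  by rewrite gee0_abs.
(* At a Lebesgue point the averaged deviation falls below d / c, and 2 phi(0) <= c bounds the
   mollification error by d. *)
- apply: lebesgue_aeS (lebesgue_differentiation lf) => x Lx.
  have small d : 0 < d -> \forall n \near \oo, `|conv (u n) f x - f x| <= d.
    move=> d0; have [r /= r0 hr] := cvge0_lt _ Lx (divr_gt0 d0 c_gt0).
    have := ucvg r r0; apply: filterS => n nr; rewrite -lee_fin.
    apply: le_trans (convolution_sub_le_davg phi_mollifier x (u0 n) lf) _.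
    have davg_lt : (davg f x (u n) < (d / c)%:E)%E.
      by apply: hr => //=; rewrite sub0r normrN gtr0_norm.
    apply: (@le_trans _ _ ((2 * phi 0)%:E * (d / c)%:E)%E).
      by rewrite lee_wpmul2l ?lee_fin ?mulr_ge0// ltW.
    by rewrite -EFinM lee_fin mulrCA ger_pMr// ler_pdivrMr// mul1r lerDl.
  apply/fine_cvgP; split; first exact: nearW.
  exact/cvgr0Pnorm_le.
- apply: le_lt_trans (amalgam_norm_quasi_triangle mp p_ge1 mw w_gt0 q_ge1
    (f := (fun x => c%:E * HL_maximal f x)%E) (g := EFin \o f) mcHL _ mh _) _.
  + exact/measurable_EFinP.
  + move=> x; rewrite habs /h leeD2r// gee0_abs// mule_ge0//.
    by rewrite lee_fin ltW.
  rewrite lte_mul_pinfty// gt_max; apply/andP; split; last by case: fa.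
  apply: le_lt_trans (amalgam_norm_scale mp p_ge1 mw w_gt0 q_ge1 mcHL mHL c_gt0 _) _.
    by move=> x; rewrite abseM gee0_abs// lee_fin ltW.
  have [C hC] := maximal_bounded; rewrite lte_mul_pinfty ?lee_fin ?(ltW c_gt0)//.
  apply: le_lt_trans (hC _ fa) _; case: fa => _ fN.
  have : N (EFin \o f) \is a fin_num by rewrite ge0_fin_numE// amalgam_norm_ge0.
  by move=> /fineK <-; rewrite -EFinM ltry.
Qed.
End amalgam_approximation.

(** * The two implications of the compactness criterion *)

Section kolmogorov_riesz.
Context {R : realType}.
Notation mu := (@lebesgue_measure R).
Variables (p w : R -> R) (q P : R).
Hypothesis mp : measurable_fun [set: R] p.
Hypothesis p_ge1 : forall x, 1 <= p x.
Hypothesis p_gt1 : {ae mu, forall x, 1 < p x}.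
Hypothesis p_le : forall x, p x <= P.
Hypothesis ww : weight w.
Hypothesis q_ge1 : 1 <= q.
Hypothesis w_muckenhoupt : muckenhoupt p w.
Variable phi : R -> R.
Hypothesis phi_mollifier : mollifier phi.

Let mw : measurable_fun [set: R] w. Proof. by case: ww => -[]. Qed.
Let w_gt0 x : 0 < w x. Proof. by case: ww => _ /(_ x). Qed.
Let phi00 : 0 <= phi 0. Proof. by case: phi_mollifier. Qed.
Notation N := (amalgam_norm p w q).
Notation conv e f := (convolution (dilation phi e) f).
Notation locint := (amalgam_locally_integrable mp p_ge1 p_gt1 ww q_ge1 w_muckenhoupt).

Variable F : set (R -> R).
Hypothesis F_amalgam : F `<=` amalgam p w q.

Let quasi_lt := amalgam_norm_quasi_lt mp p_ge1 ww q_ge1.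

Let meas_sub (f g : R -> R) : amalgam p w q f -> amalgam p w q g ->
  measurable_fun [set: R] (EFin \o (f \- g)%R).
Proof.
move=> fa ga; apply/measurable_EFinP; apply: measurable_funB.
  exact: amalgam_measurable fa.
exact: amalgam_measurable ga.
Qed.

Let meas_conv e (f : R -> R) : 0 < e -> amalgam p w q f ->
  measurable_fun [set: R] (EFin \o (conv e f \- f)%R).
Proof.
move=> e0 fa; apply/measurable_EFinP; apply: measurable_funB.
  by apply: convolution_measurable => //; exact: locint.
exact: amalgam_measurable fa.
Qed.

Let meas_tail (f : R -> R) (gamma : R) : amalgam p w q f ->
  measurable_fun [set: R] (EFin \o (f \* \1_[set x | (gamma < `|x|)%R])%R).
Proof.
move=> fa; apply/measurable_EFinP; apply: measurable_funM.
  exact: amalgam_measurable fa.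
apply: measurable_indic; rewrite -[X in measurable X]setTI.
exact: (measurable_fun_ltr (f := cst gamma) (g := fun x : R => `|x|)).
Qed.

Lemma totally_bounded_bounded : amalgam_totally_bounded p w q F ->
  (ereal_sup [set N (EFin \o f) | f in F] < +oo)%E.
Proof.
move=> /(_ 1 ltr01)[G [finG Ga hG]].
have [M hM] : exists M, forall g, G g -> (N (EFin \o g) < M%:E)%E.
  apply: (@finite_uniform _ _ G (fun g M => N (EFin \o g) < M%:E)%E) => //.
    move=> g /Ga[_ gN]; exists (fine (N (EFin \o g)) + 1).
    have gfin : N (EFin \o g) \is a fin_num by rewrite ge0_fin_numE// amalgam_norm_ge0.
    by rewrite EFinD fineK// lteDl.
  by move=> g M M' MM /lt_le_trans; apply; rewrite lee_fin.
pose m := Num.max 1 M.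
apply: le_lt_trans (ltry (8 * m)); apply: ge_ereal_sup => _ [f Ff <-].
have [g Gg fg] := hG f Ff.
have fa := F_amalgam Ff; have ga := Ga _ Gg.
have mf := amalgam_measurable fa; have mg := amalgam_measurable ga.
have mEf : measurable_fun [set: R] (EFin \o f) by exact/measurable_EFinP.
have mEg : measurable_fun [set: R] (EFin \o g) by exact/measurable_EFinP.
have fgm : (N (EFin \o (f \- g)%R) < m%:E)%E.
  by apply: lt_le_trans fg _; rewrite lee_fin le_max lexx.
have gm : (N (EFin \o g) < m%:E)%E.
  by apply: lt_le_trans (hM _ Gg) _; rewrite lee_fin le_max lexx orbT.
apply: ltW; apply: (quasi_lt (meas_sub fa ga) mEg mEf _ fgm gm) => x.
by rewrite -EFinD lee_fin/= (le_trans _ (ler_normD _ _))// subrK.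
Qed.

Lemma totally_bounded_tail (e : R) : amalgam_totally_bounded p w q F -> 0 < e ->
  exists2 gamma : R, 0 < gamma & forall f, F f ->
    (N (EFin \o (f \* \1_[set x | (gamma < `|x|)%R])%R) < e%:E)%E.
Proof.
(* The tail of f is bounded by |f - g| plus the tail of a net point g; one quasi-triangle inequality
   restores the factor 8. *)
move=> tb e0; have e80 : 0 < e / 8 by rewrite divr_gt0.
have [G [finG Ga hG]] := tb _ e80.
have [M hM] := @finite_uniform R _ G (fun g M => forall gamma : R, M <= gamma ->
  (N (EFin \o (g \* \1_[set x | (gamma < `|x|)%R])%R) < (e / 8)%:E)%E) finG
  (fun g Gg => let: ex_intro n hn :=
     amalgam_norm_tail mp p_ge1 p_le ww q_ge1 (Ga _ Gg) e80 in
     ex_intro _ n%:R hn)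
  (fun g M M' MM h gamma Mg => h gamma (le_trans MM Mg)).
pose gamma := Num.max 1 M.
exists gamma; first by rewrite lt_max ltr01.
move=> f Ff; have [g Gg fg] := hG f Ff.
have fa := F_amalgam Ff; have ga := Ga _ Gg.
have -> : e = 8 * (e / 8) by rewrite mulrC divfK.
have gtail : (N (EFin \o (g \* \1_[set x | (gamma < `|x|)%R])%R) < (e / 8)%:E)%E.
  by apply: (hM _ Gg); rewrite le_max lexx orbT.
apply: (quasi_lt (meas_sub fa ga) (meas_tail gamma ga) (meas_tail gamma fa) _ fg gtail) => x.
rewrite -EFinD lee_fin/= indicE; case: (x \in _).
  by rewrite !mulr1 (le_trans _ (ler_normD _ _))// subrK.
by rewrite !mulr0 normr0 addr0.
Qed.

(** For a net point g near f, phi_e * f - f = phi_e * (f - g) + (phi_e * g - g) - (f - g). The first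
    term is controlled by M(f - g) uniformly in e, the second by finiteness of the net. *)
Lemma totally_bounded_mollifier (eta : R) : HL_maximal_bounded p w q ->
  amalgam_totally_bounded p w q F -> 0 < eta ->
  \forall e \near 0^'+, forall f, F f ->
    (N (EFin \o (conv e f \- f)%R) < eta%:E)%E.
Proof.
move=> HM tb eta0; have [C hC] := HM.
(* Three terms are joined by two quasi-triangle inequalities, and 64 = 8 * 8. *)
pose m := eta / 64; have m0 : 0 < m by rewrite divr_gt0.
pose c := 2 * phi 0 + 1; have c0 : 0 < c by rewrite ltr_wpDl// mulr_ge0.
pose C1 := Num.max 1 C; have C10 : 0 < C1 by rewrite lt_max ltr01.
(* The bound m serves f - g itself, the bound m / (c * C1) its maximal function; [C1] replaces C
   because C need not be positive. *)
pose d := Num.min m (m / (c * C1)).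
have d0 : 0 < d by rewrite lt_min m0 divr_gt0// mulr_gt0.
have [G [finG Ga hG]] := tb _ d0.
have near_G : \forall e \near 0^'+, forall g, G g ->
    (N (EFin \o (conv e g \- g)%R) < m%:E)%E.
  have [D GE] := finite_fsetP.1 finG.
  have : nbhs (0^'+ : set_system R)
      (\bigcap_(g in [set` D]) [set e | (N (EFin \o (conv e g \- g)%R) < m%:E)%E]).
    apply: filter_bigI => g gD; have Gg : G g by rewrite GE.
    exact: (amalgam_mollifier_cvg mp p_ge1 p_gt1 p_le ww q_ge1 w_muckenhoupt
      phi_mollifier HM (Ga _ Gg) m0).
  by apply: filterS => e he g; rewrite GE => gD; exact: he.
have pos : \forall e \near 0^'+, 0 < e :> R by exact: nbhs_right_gt.
apply: filterS2 pos near_G => e e0 hGe f Ff.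
have [g Gg fg] := hG f Ff.
have fa := F_amalgam Ff; have ga := Ga _ Gg; have fga := amalgam_sub mp p_ge1 ww q_ge1 fa ga.
have lf := locint fa; have lg := locint ga; have lfg := locint fga.
have mHL := measurable_HL_maximal lfg.
have HL0 x : (0 <= HL_maximal (f \- g)%R x)%E by exact: HL_maximalT_ge0.
have mcHL : measurable_fun [set: R] (fun x => c%:E * HL_maximal (f \- g)%R x)%E.
  exact: measurable_funeM.
have cHL0 x : (0 <= c%:E * HL_maximal (f \- g)%R x)%E.
  by rewrite mule_ge0// lee_fin ltW.
pose h x := (c%:E * HL_maximal (f \- g)%R x + `|conv e g x - g x|%:E)%E.
have h0 x : (0 <= h x)%E by exact: adde_ge0.
have mh : measurable_fun [set: R] h.
  apply: emeasurable_funD mcHL _; apply/measurable_EFinP.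
  by have /measurable_EFinP mcg := meas_conv e0 ga; exact: measurableT_comp.
have NHL : (N (fun x => c%:E * HL_maximal (f \- g)%R x) < m%:E)%E.
  apply: le_lt_trans (amalgam_norm_scale mp p_ge1 mw w_gt0 q_ge1 mcHL mHL c0 _) _.
    by move=> x; rewrite abseM gee0_abs// lee_fin ltW.
  rewrite -lte_pdivlMl//; apply: le_lt_trans (hC _ fga) _.
  apply: (@le_lt_trans _ _ (C1%:E * N (EFin \o (f \- g)%R))%E).
    by apply: lee_wpmul2r; [exact: amalgam_norm_ge0|rewrite lee_fin le_max lexx orbT].
  rewrite -lte_pdivlMl//; apply: lt_le_trans fg _.
  rewrite -!EFinM lee_fin ge_min; apply/orP; right.
  by rewrite [leLHS](_ : _ = C1^-1 * (c^-1 * m))//; field; rewrite !gt_eqF.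
have Nh : (N h < (8 * m)%:E)%E.
  apply: (quasi_lt mcHL (meas_conv e0 ga) mh _ NHL (hGe _ Gg)) => x.
  by rewrite gee0_abs// gee0_abs.
have fg8 : (N (EFin \o (f \- g)%R) < (8 * m)%:E)%E.
  apply: lt_le_trans fg _; rewrite lee_fin ge_min; apply/orP; left.
  by rewrite ler_peMl ?(ltW m0)// ler1n.
have -> : eta = 8 * (8 * m) by rewrite mulrA -natrM mulrC divfK.
apply: (quasi_lt mh (meas_sub fa ga) (meas_conv e0 fa) _ Nh fg8) => x.
rewrite (gee0_abs (h0 x)).
have E : conv e f x - f x = conv e (f \- g) x + (conv e g x - g x) - (f x - g x).
  by rewrite convolutionB//; ring.
apply: (@le_trans _ _ (`|conv e (f \- g) x|%:E + `|conv e g x - g x|%:E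
    + `|f x - g x|%:E)%E).
  rewrite -!EFinD lee_fin/= E (le_trans (ler_normB _ _))// lerD2r.
  exact: ler_normD.
rewrite leeD2r// leeD2r//.
apply: le_trans (convolution_le_HL_maximal phi_mollifier x e0 lfg) _.
by rewrite lee_wpmul2r// lee_fin lerDl.
Qed.

(** If phi_e * f and phi_e * g are uniformly close on [-gamma, gamma], then f - g is dominated by
    the two mollification errors, the two tails and a small multiple of an interval indicator. *)
Lemma mollifier_totally_bounded :
  (ereal_sup [set N (EFin \o f) | f in F] < +oo)%E ->
  (forall e : R, 0 < e -> exists2 gamma : R, 0 < gamma & forall f, F f ->
    (N (EFin \o (f \* \1_[set x | (gamma < `|x|)%R])%R) < e%:E)%E) ->
  (forall eta : R, 0 < eta -> \forall e \near 0^'+, forall f, F f ->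
    (N (EFin \o (conv e f \- f)%R) < eta%:E)%E) ->
  amalgam_totally_bounded p w q F.
Proof.
move=> Foo tails moll eta eta0.
(* Five functions of norm below m are joined by four quasi-triangle inequalities. *)
pose m := eta / 8 ^+ 4; have m0 : 0 < m by rewrite divr_gt0// exprn_gt0.
have [gamma gamma0 hgamma] := tails _ m0.
have [e e0 he] : exists2 e : R, 0 < e & forall f, F f ->
    (N (EFin \o (conv e f \- f)%R) < m%:E)%E.
  have pos : \forall e \near 0^'+, 0 < e :> R by exact: nbhs_right_gt.
  have poshe : \forall e \near 0^'+, 0 < e /\
      forall f, F f -> (N (EFin \o (conv e f \- f)%R) < m%:E)%E.
    exact: filterI pos (moll _ m0).
  have [e [e0 he]] := @filter_ex _ _ (at_right_proper_filter 0) _ poshe.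
  by exists e.
have [b b0 Fb] : exists2 b : R, 0 < b & forall f, F f -> (N (EFin \o f) < b%:E)%E.
  pose s := fine (ereal_sup [set N (EFin \o f) | f in F]).
  exists (Num.max 1 (s + 1)); first by rewrite lt_max ltr01.
  move=> f Ff; have Nle : (N (EFin \o f) <= ereal_sup [set N (EFin \o f) | f in F])%E.
    by apply: ereal_sup_ubound; exists f.
  have sfin : ereal_sup [set N (EFin \o f) | f in F] \is a fin_num.
    by rewrite ge0_fin_numE// (le_trans _ Nle)// amalgam_norm_ge0.
  apply: le_lt_trans Nle _; rewrite -(fineK sfin) -/s lte_fin lt_max.
  by rewrite ltrDl ltr01 orbT.
(* Values of phi_e * f on [-gamma, gamma] depend on f over [-(gamma + e), gamma + e], which [-n, n)
   must cover. *)
pose n := (Num.truncn (gamma + e)).+1.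
have gn : gamma + e < n%:R by exact: truncnS_gt.
have gamma_n : gamma < n%:R by rewrite (lt_trans _ gn)// ltrDl.
have [K hK] := amalgam_integral_bound mp p_ge1 p_gt1 mw w_gt0 q_ge1 w_muckenhoupt n b0.
have K' f : F f ->
    (\int[mu]_(y in `[(- (gamma + e))%R, (gamma + e)%R]) `|f y|%:E <= K%:E)%E.
  move=> Ff; have mf := amalgam_measurable (F_amalgam Ff).
  apply: le_trans (hK _ mf (Fb _ Ff)); apply: ge0_subset_integral => //.
  - by apply: measurable_funTS; apply/measurable_EFinP; exact: measurableT_comp.
  - by move=> x; rewrite /= !in_itv/= => /andP[? ?]; apply/andP; split; lra.
have [L L0 hL] := convolution_lipschitz phi_mollifier.
have Oner := amalgam_indic_itv mp p_ge1 ww q_ge1 n.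
set one := (fun x => (\1_(`[(- n%:R)%R, n%:R[ : set R) x)%:E) in Oner.
have onefin : N one \is a fin_num by rewrite ge0_fin_numE// amalgam_norm_ge0.
have mone : measurable_fun [set: R] one.
  by apply/measurable_EFinP; apply: measurable_indic; exact: measurable_itv.
(* The net controls the mollified functions up to 3 * d; this choice makes 3 * d times the norm of
   the indicator smaller than m. *)
pose d := m / (fine (N one) + 1) / 3.
have N10 : 0 < fine (N one) + 1 by rewrite ltr_wpDl// fine_ge0// amalgam_norm_ge0.
have d0 : 0 < d by rewrite !divr_gt0.
have K0 : F !=set0 -> 0 <= K.
  by move=> [f Ff]; rewrite -lee_fin (le_trans _ (K' _ Ff))// integral_ge0.
(* Nonnegativity of K is read off from an element of F, so the empty family is treated apart. *)
have [F0|Fne] := pselect (F !=set0); last first.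
  by exists set0; split=> // f Ff; exfalso; apply: Fne; exists f.
have {}K0 := K0 F0.
have conv_bd f x : F f -> `|x| <= gamma -> `|conv e f x| <= phi 0 / e * K.
  move=> Ff xg; rewrite -lee_fin.
  apply: le_trans (convolution_bound phi_mollifier e0 (locint (F_amalgam Ff)) xg) _.
  rewrite [leRHS]EFinM; apply: lee_wpmul2l; last exact: K'.
  by rewrite lee_fin divr_ge0// ltW.
have conv_lip f x y : F f -> `|x| <= gamma -> `|y| <= gamma ->
    `|conv e f x - conv e f y| <= (L / e / e * K) * `|x - y|.
  move=> Ff xg yg; rewrite -lee_fin.
  apply: le_trans (hL e gamma f x y e0 (locint (F_amalgam Ff)) xg yg) _.
  rewrite (mulrAC _ K) [leRHS]EFinM; apply: lee_wpmul2l; last exact: K'.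
  by rewrite lee_fin mulr_ge0// !mulr_ge0// invr_ge0 ltW.
have lip0 : 0 <= L / e / e * K by rewrite !mulr_ge0// invr_ge0 ltW.
have [G [finG GF hG]] := uniform_net d0 lip0 conv_bd conv_lip.
exists G; split; [exact: finG|by move=> g /GF; exact: F_amalgam|].
move=> f Ff; have [g Gg fg] := hG f Ff; exists g; first exact: Gg.
have Fg := GF _ Gg; have fa := F_amalgam Ff; have ga := F_amalgam Fg.
pose t (k : R -> R) := (EFin \o (k \* \1_[set x | (gamma < `|x|)%R])%R).
pose s1 x := ((3 * d)%:E * one x)%E.
have ms1 : measurable_fun [set: R] s1 by exact: measurable_funeM.
have Ns1 : (N s1 < m%:E)%E.
  have d30 : 0 < 3 * d by rewrite mulr_gt0.
  apply: le_lt_trans (amalgam_norm_scale mp p_ge1 mw w_gt0 q_ge1 ms1 mone d30 _) _.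
    by move=> x; rewrite abseM gee0_abs// lee_fin ltW.
  rewrite -(fineK onefin) -EFinM lte_fin.
  have -> : 3 * d = m / (fine (N one) + 1) by rewrite /d mulrC divfK.
  by rewrite mulrAC ltr_pdivrMr// ltr_pM2l// ltrDl.
(* Adds one more term of norm below m to a partial sum s of norm below c, at the price of the bound
   8 * c. *)
have step (k s : R -> \bar R) (c : R) : m <= c -> measurable_fun [set: R] k ->
    measurable_fun [set: R] s -> (forall x, (0 <= s x)%E) ->
    (N k < m%:E)%E -> (N s < c%:E)%E ->
    [/\ measurable_fun [set: R] (fun x => `|k x| + s x)%E,
       (forall x, (0 <= `|k x| + s x)%E) &
       (N (fun x => `|k x| + s x)%E < (8 * c)%:E)%E].
  move=> mc mk ms s0 Nk Ns; have mabs : measurable_fun [set: R] (fun x => `|k x|)%E.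
    exact: measurableT_comp.
  have mks : measurable_fun [set: R] (fun x => `|k x| + s x)%E by exact: emeasurable_funD.
  have Nkc : (N k < c%:E)%E by apply: lt_le_trans Nk _; rewrite lee_fin.
  split; [exact: mks|by move=> x; rewrite adde_ge0|].
  apply: (quasi_lt mk ms mks _ Nkc Ns) => x.
  by rewrite gee0_abs ?adde_ge0// (gee0_abs (s0 x)).
have up (c : R) : m <= c -> m <= 8 * c by lra.
have s10 x : (0 <= s1 x)%E.
  by apply: mule_ge0; rewrite lee_fin; [rewrite mulr_ge0// ltW|by rewrite indicE ler0n].
have [m2 p2 N2] := step (t f) s1 m (lexx _) (meas_tail gamma fa) ms1 s10 (hgamma _ Ff) Ns1.
have [m3 p3 N3] := step (t g) _ _ (up _ (lexx _)) (meas_tail gamma ga) m2 p2 (hgamma _ Fg) N2.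
have [m4 p4 N4] := step _ _ _ (up _ (up _ (lexx _))) (meas_conv e0 ga) m3 p3 (he _ Fg) N3.
have -> : eta = 8 * (8 * (8 * (8 * m))).
  by rewrite /m !exprS expr0; field.
have Ncf : (N (EFin \o (conv e f \- f)%R) < (8 * (8 * (8 * m)))%:E)%E.
  by apply: lt_le_trans (he _ Ff) _; rewrite lee_fin; exact: (up _ (up _ (up _ (lexx _)))).
apply: (quasi_lt (meas_conv e0 fa) m4 (meas_sub fa ga) _ Ncf N4) => x.
rewrite [in leRHS](gee0_abs (p4 x)) /s1 /t /one /=.
  rewrite -!(EFinD, EFinM) lee_fin.
  (* Inside, f - g telescopes through the mollified functions and the indicator equals 1; outside,
     |f - g| <= |f| + |g| is already the sum of the tails. *)
  have [xg|xg] := leP `|x| gamma.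
    have -> : \1_(`[(- n%:R)%R, n%:R[ : set R) x = 1 :> R.
      have : `|x| < n%:R by exact: le_lt_trans gamma_n.
      by rewrite ltr_norml indicE => /andP[/ltW xn nx]; rewrite mem_set//= in_itv/= xn.
    rewrite mulr1; have := fg _ xg.
    have -> : f x - g x = - (conv e f x - f x) + (conv e f x - conv e g x)
       + (conv e g x - g x) by ring.
    set A := `|f x * _|; set B := `|g x * _|.
    have A0 : 0 <= A by exact: normr_ge0. have B0 : 0 <= B by exact: normr_ge0.
    move=> h; have := ler_normD (- (conv e f x - f x) + (conv e f x - conv e g x))
      (conv e g x - g x).
    have := ler_normD (- (conv e f x - f x)) (conv e f x - conv e g x).
    by rewrite normrN; lra.
  have -> : \1_[set x : R | gamma < `|x|] x = 1 :> R by rewrite indicE mem_set.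
  rewrite !mulr1.
  have := ler_normB (f x) (g x); have := normr_ge0 (conv e f x - f x).
  have := normr_ge0 (conv e g x - g x).
  have : 0 <= 3 * d * \1_(`[(- n%:R)%R, n%:R[ : set R) x.
    by apply: mulr_ge0; [rewrite mulr_ge0// ltW|rewrite indicE].
  lra.
Qed.
End kolmogorov_riesz.

Theorem theorem8 (R : realType) (p w : R -> R) (q : R) (phi : R -> R)
    (hp : log_hoelder_exponent p)
    (hpminus : (1 < ess_inf (@lebesgue_measure R) (EFin \o p))%E)
    (hpplus : (ess_sup (@lebesgue_measure R) (EFin \o p) < +oo)%E)
    (hq : 1 <= q)
    (hw : weight w) (hwA : muckenhoupt p w)
    (hM : HL_maximal_bounded p w q)
    (hphi : mollifier phi)
    (F : set (R -> R)) (hF : F `<=` amalgam p w q) :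
  amalgam_totally_bounded p w q F <->
  [/\ (ereal_sup [set amalgam_norm p w q (EFin \o f) | f in F] < +oo)%E,
      forall e : R, 0 < e -> exists2 gamma : R, 0 < gamma &
        forall f, F f ->
          (amalgam_norm p w q (EFin \o (f \* \1_[set x | gamma < `|x|])%R)
            < e%:E)%E &
      forall eta : R, 0 < eta -> \forall e \near 0^'+,
        forall f, F f ->
          (amalgam_norm p w q (EFin \o (convolution (dilation phi e) f \- f)%R)
            < eta%:E)%E].
Proof.
have [[mp p_ge1] _] := hp.
have [P p_le] := log_hoelder_bounded hp.
have p_gt1 := ess_inf_gt1 hpminus.
split=> [tb|[Foo tails moll]]; last first.
  exact: (mollifier_totally_bounded mp p_ge1 p_gt1 hw hq hwA hphi hF Foo tails moll).
split.
- exact: (totally_bounded_bounded mp p_ge1 hw hq hF tb).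
- by move=> e e0; exact: (totally_bounded_tail mp p_ge1 p_le hw hq hF tb e0).
- move=> eta eta0.
  exact: (totally_bounded_mollifier mp p_ge1 p_gt1 p_le hw hq hwA hphi hF hM tb eta0).
Qed.
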